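(* Let $q\ge 2$ be an integer and let $\mathcal A$ be a totally ordered alphabet with $q$ letters. For $n\ge 2$, let $\mathcal L_n$ be the set of Lyndon words of length $n$ on $\mathcal A$, endowed with the uniform probability measure, and for $w\in\mathcal L_n$ let $R_n(w)$ be the length of the standard right factor of $w$. Then, as $n\to\infty$, the random variable $R_n/n$ converges in distribution to the probability measure $$\mu(dx)=\frac1q\,\delta_1(dx)+\frac{q-1}{q}\,\mathbf 1_{[0,1)}(x)\,dx,$$ where $\delta_1$ denotes the Dirac mass at the point $1$ and $dx$ denotes Lebesgue measure on $\mathbb R$. Moreover, all the moments of $R_n/n$ converge to the corresponding moments of $\mu$.
   Context: A Lyndon word of length $n$ is a word of length $n$ on $\mathcal A$ that is strictly smaller, for the lexicographic order, than each of its proper (nonempty) suffixes. The standard right factor of a Lyndon word $w$ (of length at least $2$) is its smallest proper nonempty suffix for the lexicographic order. *)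

(* Defs.v *)
From HB Require Import structures.
From mathcomp Require Import all_boot all_order all_algebra.
From mathcomp Require Import finmap zify.
From mathcomp Require Import all_classical all_reals all_analysis.

Set Implicit Arguments.
Unset Strict Implicit.
Unset Printing Implicit Defensive.

Import Order.TTheory GRing.Theory Num.Theory.
Import numFieldNormedType.Exports.
Import Order.DefaultSeqLexiOrder.

Local Open Scope classical_set_scope.
Local Open Scope ring_scope.

Section Words.
Context {d : Order.disp_t} {A : finOrderType d}.
Implicit Types w s : seq A.

Definition proper_suffixes w : seq (seq A) :=
  [seq drop i w | i <- iota 1 (size w).-1].

Lemma mem_proper_suffixes w s :
  (s \in proper_suffixes w) = [&& suffix s w, s != [::] & s != w].
Proof.
apply/mapP/and3P => [[i]|[/suffixP[t ->] s0 sw]].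
  rewrite mem_iota => /andP[i0 ilt] ->; have iw : (i < size w)%N by lia.
  split.
  - by apply/suffixP; exists (take i w); rewrite cat_take_drop.
  - by rewrite -size_eq0 size_drop subn_eq0 -ltnNge.
  - apply/eqP => /(congr1 (@size A)); rewrite size_drop => e.
    by move: e iw i0; clear; lia.
exists (size t); last by rewrite drop_size_cat.
have s1 : (0 < size s)%N by rewrite lt0n size_eq0.
have t1 : (0 < size t)%N.
  by rewrite lt0n size_eq0; apply/eqP => t0; rewrite t0 eqxx in sw.
rewrite mem_iota size_cat; move: s1 t1; clear.
by move: (size s) (size t) => a b; lia.
Qed.

Definition lyndon w : bool := all (fun s => (w < s)%O) (proper_suffixes w).

(* [behead w] is itself a proper nonempty suffix as soon as [1 < size w], so it
   is a neutral starting value for the minimum. *)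
Definition std_rfactor w : seq A :=
  \big[Order.min/behead w]_(s <- proper_suffixes w) s.

Lemma std_rfactorP w : (1 < size w)%N ->
  (std_rfactor w \in proper_suffixes w) /\
  (forall s, s \in proper_suffixes w -> (std_rfactor w <= s)%O).
Proof.
move=> w1; have b : behead w \in proper_suffixes w.
  by apply/mapP; exists 1%N; rewrite ?drop1// mem_iota; lia.
split=> [|s]; last first.
  rewrite /std_rfactor; elim: proper_suffixes => // x r IHr.
  by rewrite in_cons big_cons ge_min => /predU1P[->|/IHr ->]; rewrite ?lexx ?orbT.
rewrite /std_rfactor big_seq.
by apply: (big_ind (fun s => s \in proper_suffixes w)) => // x y ? ?;
  rewrite minEle; case: ifP.
Qed.

End Words.

Section LyndonWords.
Context {d : Order.disp_t} {A : finOrderType d} {q : nat}.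

Lemma ex_lyndon (cardA : #|A| = q) (q_gt1 : (1 < q)%N) (n : nat) :
  exists w : n.-tuple A, lyndon (w : seq A).
Proof.
have /card_gt1P[x [y [_ _ xy]]] : (1 < #|A|)%N by rewrite cardA.
wlog lxy : x y xy / (x < y)%O.
  by move=> H; move: (xy); rewrite neq_lt => /orP[]; apply: H => //; rewrite eq_sym.
case: n => [|n]; first by exists [tuple].
exists [tuple of x :: nseq n y]; apply/allP => s /mapP[i].
rewrite mem_iota /= size_nseq => /andP[i0 ilt].
case: i i0 ilt => // i _ ilt ->; rewrite drop_cons drop_nseq.
have : (0 < n - i)%N by lia.
by case: (n - i)%N => // m _; rewrite neqhead_ltxiE// lt_eqF.
Qed.

(* The two proofs make the type visibly inhabited, which the library requires
   of every measurable type. *)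
Record lyndon_word (cardA : #|A| = q) (q_gt1 : (1 < q)%N) (n : nat) :=
  LyndonWord { lyndon_tuple :> n.-tuple A ; _ : lyndon lyndon_tuple }.

Context {cardA : #|A| = q} {q_gt1 : (1 < q)%N} {n : nat}.
Local Notation L := (lyndon_word cardA q_gt1 n).

HB.instance Definition _ := [isSub for @lyndon_tuple cardA q_gt1 n].
HB.instance Definition _ := [Finite of L by <:].

Lemma lyndon_word_inhabited : exists w : L, true.
Proof. by have [w lw] := ex_lyndon cardA q_gt1 n; exists (LyndonWord _ _ lw). Qed.

HB.instance Definition _ := isPointed.Build L (xchoose lyndon_word_inhabited).
HB.instance Definition _ := @isMeasurable.Build default_measure_display
  L discrete_measurable discrete_measurable0
  discrete_measurableC discrete_measurableU.

End LyndonWords.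

Section UniformLaw.
Context {d : Order.disp_t} {A : finOrderType d} {q : nat}.
Context (R : realType) (cardA : #|A| = q) (q_gt1 : (1 < q)%N) (n : nat).
Local Notation L := (lyndon_word cardA q_gt1 n).

Definition lyndon_unif : set L -> \bar R :=
  mscale (#|{: L}|%:R^-1)%:nng counting.

HB.instance Definition _ := Measure.on lyndon_unif.

Let lyndon_unif_setT : lyndon_unif setT = 1%E.
Proof.
have fL : finite_set [set: L] by exact: finite_finset.
rewrite /lyndon_unif /mscale /= /counting asboolT//.
rewrite -EFinM; congr EFin.
have -> : fset_set [set: L] = [fset x | x in {: L}]%fset.
  apply/fsetP => x; rewrite in_fset_set// in_setT.
  by apply/esym/imfsetP; exists x.
rewrite card_finset mulVf// pnatr_eq0 -lt0n.
by apply/card_gt0P; exists point.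
Qed.

HB.instance Definition _ := Measure_isProbability.Build _ _ _ lyndon_unif
  lyndon_unif_setT.

(* Meaningful for [1 < n]; the junk values at [n < 2] do not affect limits. *)
Definition rfactor_ratio (w : L) : R :=
  (size (std_rfactor (w : seq A)))%:R / n%:R.

Let measurable_rfactor_ratio : measurable_fun setT rfactor_ratio.
Proof. by []. Qed.

HB.instance Definition _ := isMeasurableFun.Build _ _ _ _ rfactor_ratio
  measurable_rfactor_ratio.

End UniformLaw.
Arguments lyndon_unif {d A q} R cardA q_gt1 n _.
Arguments rfactor_ratio {d A q} R cardA q_gt1 n w.

Section LimitLaw.
Context (R : realType) (q : nat) (q_gt1 : (1 < q)%N).

(* The unused proof lets [limit_law] carry a canonical probability structure. *)
Definition limit_law (_ : (1 < q)%N) : set (measurableTypeR R) -> \bar R :=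
  measure_add
    (mscale (q%:R^-1)%:nng (dirac (1 : measurableTypeR R)))
    (mscale ((q - 1)%N%:R / q%:R)%:nng
       (mrestr (@lebesgue_measure R) (measurable_itv `[0 : R, 1[))).

HB.instance Definition _ := Measure.on (limit_law q_gt1).

Let limit_law_setT : limit_law q_gt1 setT = 1%E.
Proof.
have dT : dirac (1 : measurableTypeR R) setT = 1%E :> \bar R.
  by rewrite diracE mem_set.
have lT : lebesgue_measure (setT `&` `[0 : R, 1[) = 1%E.
  by rewrite setTI lebesgue_measure_itv /= lte_fin ltr01 -EFinB subr0.
transitivity ((q%:R^-1)%:E * 1 + ((q - 1)%N%:R / q%:R)%:E * 1 : \bar R)%E.
  by rewrite -{1}dT -lT /limit_law measure_addE.
rewrite !mule1 -EFinD; congr EFin.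
rewrite -[X in X + _]div1r -mulrDl -(natrD _ 1) subnKC ?(ltnW q_gt1)//.
by rewrite divff// pnatr_eq0 -lt0n (ltnW q_gt1).
Qed.

HB.instance Definition _ := Measure_isProbability.Build _ _ _ (limit_law q_gt1)
  limit_law_setT.

End LimitLaw.
Arguments limit_law R {q} _ _.

Definition cvg_in_distribution (R : realType) (d : nat -> measure_display)
    (T : forall n, measurableType (d n)) (P : forall n, probability (T n) R)
    (X : forall n, {RV (P n) >-> R}) (mu : probability (measurableTypeR R) R) :
    Prop :=
  forall f : R -> R, continuous f -> bounded_fun f ->
    (\int[distribution (P n) (X n)]_x (f x)%:E)%E @[n --> \oo]
      --> (\int[mu]_x (f x)%:E)%E.
Arguments cvg_in_distribution {R d T} P X mu.

(* Main.v *)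
(** Write a Lyndon word [w] of length [n], whose first letter is generically the
    least letter [a], as [w = a :: t].  The standard right factor is the least
    proper suffix.  It starts at position 1 iff [t] is itself a Lyndon word, which
    has probability about [1/q] since there are about [q^n / n] Lyndon words of
    length [n].

    Otherwise it starts at a position [j > 1] which turns out to be almost uniform
    on [1, n].  Let [h] be slightly less than [log_q n] and [m] a large multiple of
    [log n].  Up to [o(q^n / n)] words, [w] starts with more than [h] letters [a],
    its factors of length [m] are distinct, and the suffixes starting with
    [a^h] are ordered by their first [m] letters; among these, [w] is the least
    and the standard right factor the second least.  Cutting out the middle part
    of [w] and exchanging two consecutive pieces of it preserves these factors of
    length [m], provided that no run of [h/2] letters [a] meets the cuts, so it
    sends Lyndon words to Lyndon words and just translates [j].  Hence all blocks
    of positions of equal length have the same asymptotic probability.  Every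
    exceptional set is so small that a union bound suffices, because forcing [w]
    to start with [a^h] already costs a factor [q^-h]. *)

Require Import Defs.
From HB Require Import structures.
From mathcomp Require Import all_boot all_order all_algebra.
From mathcomp Require Import zify ring lra.
From mathcomp Require Import all_classical all_reals all_analysis.
From mathcomp Require Import measurable_realfun.

Set Implicit Arguments.
Unset Strict Implicit.
Unset Printing Implicit Defensive.

Import Order.TTheory GRing.Theory Num.Theory.
Import numFieldNormedType.Exports.
Import Order.DefaultSeqLexiOrder.

(* Lemmas on eqTypes and on ordered types state [size w] over different carriers
   of the same alphabet; [lia] only identifies them once they are normalized. *)
Ltac slia := intros;
  repeat match goal with
  | A : Order.FinTotal.type _ |- context [@size ?T ?w] =>
    tryif constr_eq T (Order.FinTotal.sort A) then fail
    else change (@size T w) with (@size (Order.FinTotal.sort A) w)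
  | A : Order.FinTotal.type _, H : context [@size ?T ?w] |- _ =>
    tryif constr_eq T (Order.FinTotal.sort A) then fail
    else change (@size T w) with (@size (Order.FinTotal.sort A) w) in H
  end; lia.

(** * Lexicographic order and Lyndon words *)

Section Lexicographic.
Context {d : Order.disp_t} {A : finOrderType d}.
Implicit Types (x y : A) (s t u v : seq A).

Lemma ltxi_catl s t u : ((s ++ t < s ++ u) = (t < u))%O.
Proof. by elim: s => //= x s <-; rewrite eqhead_ltxiE. Qed.

(** When [s] is not a prefix of [t], the comparison is decided at a letter that both words have. *)
Lemma ltxi_cat s t u v : ~~ prefix s t -> (s < t)%O -> (s ++ u < t ++ v)%O.
Proof.
elim: s t => [|x s IHs] [|y t] //=; rewrite negb_and.
have [<-{y} /=|nxy _] := eqVneq x y; first by rewrite !eqhead_ltxiE; exact: IHs.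
by rewrite !neqhead_ltxiE.
Qed.

Lemma ltxi_cat_size s t u v : size s = size t -> (s < t)%O -> (s ++ u < t ++ v)%O.
Proof.
move=> st lst; apply: ltxi_cat => //; apply/negP => /prefixP[r tE].
move: st; rewrite tE size_cat -[LHS]addn0 => /addnI/esym/size0nil r0.
by move: lst; rewrite tE r0 cats0 ltxx.
Qed.

Lemma lexi_take k s t : (s <= t)%O -> (take k s <= take k t)%O.
Proof.
elim: k s t => [|k IHk] [|x s] [|y t] //=; rewrite ?lexi0s //.
by rewrite !lexi_cons => /andP[-> /=]; case: (y <= x)%O => //=; exact: IHk.
Qed.

Lemma ltxi_take k s t : (take k s < take k t)%O -> (s < t)%O.
Proof. by rewrite !ltNge; apply: contra; exact: lexi_take. Qed.

End Lexicographic.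

Section LyndonWords.
Context {d : Order.disp_t} {A : finOrderType d}.
Implicit Types (x y : A) (s t u v w : seq A).

Lemma lyndonP w :
  reflect (forall i, 0 < i < size w -> (w < drop i w)%O) (lyndon w).
Proof.
apply: (iffP allP) => [H i iw | H s /mapP[i]].
  by apply: H; apply/mapP; exists i => //; rewrite mem_iota; lia.
by rewrite mem_iota => iw ->; apply: H; lia.
Qed.

Lemma std_rfactor_drop w : 1 < size w -> exists2 j,
  0 < j < size w & std_rfactor w = drop j w /\
    forall i, 0 < i < size w -> (drop j w <= drop i w)%O.
Proof.
move=> w1; have [/mapP[j jw jE] min] := std_rfactorP w1.
rewrite mem_iota in jw; exists j; first by lia.
split=> // i iw; rewrite -jE; apply: min.
by apply/mapP; exists i => //; rewrite mem_iota; lia.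
Qed.

Lemma std_rfactor_unique w j : 0 < j < size w ->
  (forall i, 0 < i < size w -> (drop j w <= drop i w)%O) ->
  std_rfactor w = drop j w.
Proof.
move=> jw min; have [|i iw [-> mini]] := @std_rfactor_drop w; first by lia.
by apply: le_anti; rewrite mini//= min.
Qed.

Definition std_pos w := size w - size (std_rfactor w).

Lemma std_posP w : 1 < size w -> [/\ 0 < std_pos w < size w,
  std_rfactor w = drop (std_pos w) w &
  forall i, 0 < i < size w -> (drop (std_pos w) w <= drop i w)%O].
Proof.
move=> /std_rfactor_drop[j jw [jE min]].
by have -> : std_pos w = j by rewrite /std_pos jE size_drop; lia.
Qed.

Lemma std_pos_unique w j : 0 < j < size w ->
  (forall i, 0 < i < size w -> (drop j w <= drop i w)%O) -> std_pos w = j.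
Proof.
by move=> jw /(std_rfactor_unique jw); rewrite /std_pos => ->; rewrite size_drop; lia.
Qed.

Lemma lyndon_rot_gt w i : lyndon w -> 0 < i < size w -> (w < rot i w)%O.
Proof.
move=> lw iw; have lti := lyndonP _ lw i iw.
rewrite /rot -[X in (X < _)%O]cats0; apply: ltxi_cat => //.
apply/negP => /size_prefix; rewrite size_drop; slia.
Qed.

(** Suppose a proper suffix [s] is at most [w]. If [s] is not a prefix of [w], the rotation
    beginning with [s] is below [w]. If [w = s ++ u], comparing [w] with that rotation gives
    [u < take i w], two words of equal length, so the rotation [u ++ s] is below [w]. *)
Lemma rot_min_lyndon w :
  (forall i, 0 < i < size w -> (w < rot i w)%O) -> lyndon w.
Proof.
move=> H; apply/lyndonP => i iw; have := H _ iw; rewrite /rot.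
set s := drop i w => lws; rewrite ltNge; apply/negP => sw.
have [/prefixP[u wE]|nps] := boolP (prefix s w); last first.
  have sw' : (s < w)%O.
    by rewrite lt_neqAle sw andbT; apply: contra nps => /eqP ->; rewrite prefix_refl.
  by have := ltxi_cat (take i w) [::] nps sw'; rewrite cats0; case: ltgtP lws.
have us : (u < take i w)%O by move: lws; rewrite {1}wE ltxi_catl.
have szu : size u = size (take i w).
  have := congr1 size wE; rewrite size_cat size_drop size_takel; slia.
have : (u ++ s < w)%O by rewrite -[w](cat_take_drop i); exact: ltxi_cat_size.
have /H : 0 < size s < size w by rewrite size_drop; lia.
by rewrite {2}wE rot_size_cat; case: ltgtP.
Qed.

End LyndonWords.

(** * Long runs of the least letter *)

Section Runs.
Context {d : Order.disp_t} {A : finOrderType d} (a : A).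
Hypothesis a_min : forall x, (a <= x)%O.
Implicit Types (x y : A) (s t u v w : seq A) (h k m i j : nat).

Definition run k s := take k s == nseq k a.

Lemma runE k s : run k s = (take k s == nseq k a).
Proof. by []. Qed.

Lemma run0 s : run 0 s.
Proof. by rewrite /run take0. Qed.

Lemma run_size k s : run k s -> k <= size s.
Proof.
move=> /eqP /(congr1 size); rewrite size_nseq size_take.
by case: ltnP => [/ltnW //|_ ->].
Qed.

Lemma runS k x s : run k.+1 (x :: s) = (x == a) && run k s.
Proof. by rewrite /run /= eqseq_cons. Qed.

Lemma run_leq k k' s : k' <= k -> run k s -> run k' s.
Proof.
elim: k' k s => [|k' IH] [|k] [|x s] kk //; rewrite ?runS => // /andP[-> /=].
exact: IH.
Qed.

Lemma run_drop k i s : run k s -> run (k - i) (drop i s).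
Proof.
elim: i k s => [|i IH] k s; first by rewrite subn0 drop0.
case: k s => [|k] s; first by rewrite sub0n !run0.
case: s => // x s.
rewrite runS => /andP[_ /IH].
by rewrite subSS.
Qed.

Lemma run_catl k s t : run k s -> run k (s ++ t).
Proof. by move=> rs; rewrite /run takel_cat// run_size. Qed.

Lemma run_catE k s t : k <= size s -> run k (s ++ t) = run k s.
Proof. by move=> ks; rewrite /run takel_cat. Qed.

(** The condition on the last letter excludes that [t] is a shorter power of [a], hence a prefix of
    [s]; the default [a] makes it exclude the empty word too. *)
Lemma nonrun_gt k s t : run k s -> ~~ run k t -> last a t != a -> (s < t)%O.
Proof.
elim: k s t => [|k IH] [|x s] [|y t] //=; rewrite ?eqxx// !runS.
move=> /andP[/eqP -> rs]; case: (eqVneq y a) => [-> /=|ya _ _].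
  by rewrite eqhead_ltxiE; exact: IH.
by rewrite neqhead_ltxiE 1?eq_sym// lt_neqAle eq_sym ya a_min.
Qed.

Lemma last_drop x s i : i < size s -> last x (drop i s) = last x s.
Proof.
by move=> si; rewrite -{2}(cat_take_drop i s) last_cat (drop_nth x si).
Qed.

Lemma lyndon_last w : 1 < size w -> lyndon w -> last a w != a.
Proof.
move=> w1 /lyndonP /(_ (size w).-1) lw; apply/eqP => lwa.
have /lw : 0 < (size w).-1 < size w by lia.
rewrite (drop_nth a) ?prednK ?drop_oversize//; try lia.
rewrite nth_last lwa; case: w w1 {lw lwa} => // x w _.
by rewrite ltxi_cons a_min /= => /andP[_]; rewrite ltxis0.
Qed.

(** Otherwise the suffix with the run would be below [w]. So a long run anywhere forces one at the
    start, the event that the union bounds pay for. *)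
Lemma lyndon_run k w i : 1 < size w -> lyndon w -> run k (drop i w) -> run k w.
Proof.
move=> w1 lw ri; have [->|k0] := posnP k; first by rewrite run0.
have iw : i < size w by have := run_size ri; rewrite size_drop; lia.
have [i0|i0] := posnP i; first by rewrite i0 drop0 in ri.
apply: contraT => /(nonrun_gt ri) /(_ (lyndon_last w1 lw)).
by rewrite ltNge ltW//; apply: (lyndonP _ lw); rewrite i0.
Qed.

(* The factor of length [m] at position [i], truncated near the end of [w]. *)
Definition win m i w := take m (drop i w).

(** A certificate that [w] is Lyndon with standard factor at [j]. It refers only to the windows at
    runs of length [h], which makes it stable under the exchange of factors. *)
Definition lead_pair h m w j := [/\ 0 < j < size w, run h w, run h (drop j w),
  (win m 0 w < win m j w)%O &
  forall i, 0 < i -> i != j -> run h (drop i w) -> (win m j w < win m i w)%O].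

Lemma lead_pair_lyndon h m w j : last a w != a -> lead_pair h m w j ->
  lyndon w /\ std_pos w = j.
Proof.
move=> lwa [jw r0 rj w0j minj].
have lt0j : (w < drop j w)%O by rewrite -{1}(drop0 w); exact: ltxi_take w0j.
have ltji i : 0 < i < size w -> i != j -> (drop j w < drop i w)%O.
  move=> /andP[i0 iw] ij; have [ri|nri] := boolP (run h (drop i w)).
    exact: ltxi_take (minj i i0 ij ri).
  by apply: nonrun_gt rj nri _; rewrite last_drop.
split.
  apply/lyndonP => i iw; have [->//|ij] := eqVneq i j.
  exact: lt_trans lt0j (ltji i iw ij).
apply: std_pos_unique => // i iw; have [->//|ij] := eqVneq i j.
exact/ltW/ltji.
Qed.

Definition dup_win m w :=
  has (fun j => has (fun i => win m i w == win m j w) (iota 0 j))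
      (iota 0 (size w - m).+1).

Lemma dup_winPn m w i j : ~~ dup_win m w -> i < j -> j + m <= size w ->
  win m i w != win m j w.
Proof.
move=> /hasPn H ij jw; have /H /hasPn : j \in iota 0 (size w - m).+1.
  by rewrite mem_iota; lia.
by apply; rewrite mem_iota; lia.
Qed.

(** The suffix at position 1 begins with [a^h], so the least proper suffix does too. The bound on
    the position makes the initial run of length [h + 1] disjoint from this one, as [nwords_runs]
    requires. *)
Lemma lyndon_std_pos_run h w : 1 < size w -> lyndon w -> run h.+1 w ->
  1 < std_pos w -> run h (drop (std_pos w) w) /\ h < std_pos w.
Proof.
move=> w1 lw rw j1; have [jw _ minj] := std_posP w1.
set j := std_pos w in j1 jw minj *.
have lj i : i < size w -> last a (drop i w) != a.
  by move=> iw; rewrite last_drop//; exact: lyndon_last.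
have rj : run h (drop j w).
  apply: contraT => nrj; have := minj 1; rewrite w1 => /(_ isT).
  rewrite leNgt (nonrun_gt _ nrj)//; last by apply: lj; lia.
  by have := run_drop 1 rw; rewrite subn1.
split=> //; rewrite ltnNge; apply/negP => jh.
(* If [j <= h] the suffix at [j - 1] is [a :: v] with [v] the suffix at [j];
   as [v] begins with [a] and is least, [a :: v < v]. *)
have := minj j.-1; have -> : 0 < j.-1 < size w by lia.
move=> /(_ isT); rewrite leNgt => /negP; apply.
have -> : drop j.-1 w = a :: drop j w.
  rewrite (drop_nth a); last lia.
  rewrite prednK; last lia.
  congr cons; move: (run_drop j.-1 rw).
  rewrite (drop_nth a); last lia.
  by rewrite -[h.+1 - _]prednK ?runS; [move=> /andP[/eqP]|lia].
have djE : drop j w = nth a w j :: drop j.+1 w by rewrite -drop_nth//; lia.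
have := a_min (nth a w j); rewrite le_eqVlt => /predU1P[ja|lt]; last first.
  by rewrite djE neqhead_ltxiE ?lt// lt_eqF.
rewrite {2}djE -ja eqhead_ltxiE.
have [jw1|jw1] := ltnP j.+1 (size w); last first.
  by have := lj j; rewrite djE drop_oversize //= -ja eqxx; lia.
rewrite lt_neqAle minj ?andbT; last by lia.
by apply/eqP => /(congr1 size); rewrite !size_drop; slia.
Qed.

(** Partial converse of [lead_pair_lyndon]: truncation to [m] letters keeps weak inequalities, and
    untruncated distinct windows make them strict. *)
Lemma lyndon_lead_pair h m w : 0 < m -> 1 < size w -> lyndon w -> run h.+1 w ->
  1 < std_pos w -> ~~ dup_win m w ->
  (forall i, run h (drop i w) -> i + m <= size w) ->
  lead_pair h m w (std_pos w).
Proof.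
move=> m0 w1 lw rw j1 dup runm; have [jw _ minj] := std_posP w1.
have [rj _] := lyndon_std_pos_run w1 lw rw j1.
split=> //; first exact: run_leq rw.
  rewrite lt_neqAle dup_winPn//; [|lia|exact: runm].
  by rewrite lexi_take// drop0 ltW//; exact: (lyndonP _ lw).
move=> i i0 ij ri; have im := runm i ri.
rewrite lt_neqAle lexi_take ?andbT; last by apply: minj; lia.
have := dup_winPn dup; case: (ltngtP i (std_pos w)) ij => // ij _ H.
  by rewrite eq_sym H// runm.
exact: H.
Qed.
End Runs.

(** * Exchanging two factors *)

Section Transport.
Context {d : Order.disp_t} {A : finOrderType d} (a : A).
Hypothesis a_min : forall x, (a <= x)%O.
Implicit Types (p q r w x y z : seq A) (h g m i j : nat).
Local Notation run := (run a).
Local Notation lead_pair := (lead_pair a).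

Variables (h g m : nat).
Hypotheses (g0 : 0 < g) (gh : g.*2 <= h.+1) (hm : h <= m).

(* A run of length [h] that straddles a cut leaves a run of length [g] at the end
   of the left piece or at the beginning of the right one, as [2 g <= h + 1]. *)
Definition tail_free p := forall i, size p < i + m -> ~~ run g (drop i p).

Lemma run_split p q i : tail_free p -> ~~ run g q -> run h (drop i (p ++ q)) ->
  (i + m <= size p) || (size p <= i).
Proof.
move=> tp hq; rewrite drop_cat; case: (ltnP i (size p)) => ip; last by rewrite orbT.
rewrite orbF => ri; rewrite leqNgt; apply/negP => /tp.
case: (leqP g (size p - i)) => gl.
  rewrite -(@run_catE _ _ _ _ _ q) ?size_drop// => /negP; apply.
  by apply: run_leq ri; lia.
move=> _; move/negP: hq; apply; have := run_drop (size p - i) ri.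
by rewrite drop_size_cat ?size_drop// => /run_leq; apply; lia.
Qed.

Lemma run_take s : run h (take m s) = run h s.
Proof. by rewrite !runE take_takel. Qed.

Lemma win_mid p q r i : i + m <= size q ->
  win m (size p + i) (p ++ q ++ r) = win m i q.
Proof.
move=> iq; rewrite /win drop_cat ltnNge leq_addr /= addKn drop_cat.
case: ltnP => iq'; first by rewrite takel_cat// size_drop; lia.
have -> : m = 0 by lia.
by rewrite !take0.
Qed.

(** Where position [i] of [w ++ x ++ y ++ z] goes in [w ++ y ++ x ++ z], for [w], [x], [y] of
    lengths [c], [u], [v]. *)
Definition swap_pos c u v i :=
  if i < c then i else if i < c + u then i + v
  else if i < c + u + v then i - u else i.

Lemma swap_posK c u v : cancel (swap_pos c u v) (swap_pos c v u).
Proof.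
move=> i; rewrite /swap_pos; case: (ltnP i c) => [->//|ci].
case: (ltnP i (c + u)) => [iu|ui].
  do 2 (rewrite ifF; last lia); rewrite ifT; lia.
case: (ltnP i (c + u + v)) => [iv|vi].
  rewrite ifF; last lia; rewrite ifT; lia.
by do 3 (rewrite ifF; last lia).
Qed.

(** No run of length [g] meets the three cuts or comes close to the end of the word. The condition
    is symmetric in [x] and [y], so it also holds after the exchange. *)
Definition clean w x y z :=
  [/\ [/\ tail_free w, tail_free x, tail_free y & tail_free z],
      [/\ ~~ run g x, ~~ run g y & ~~ run g z]
    & [/\ 0 < size w, g <= size x, g <= size y & g <= size z]].

Lemma clean_sym w x y z : clean w x y z -> clean w y x z.
Proof. by case=> [[? ? ? ?] [? ? ?] [? ? ? ?]]. Qed.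

(** By [run_split] at each cut in turn, a run of length [h] lies with its whole window inside one of
    the four pieces, and pieces move rigidly. *)
Lemma clean_run w x y z i : clean w x y z ->
  run h (drop i (w ++ x ++ y ++ z)) ->
  win m (swap_pos (size w) (size x) (size y) i) (w ++ y ++ x ++ z) =
    win m i (w ++ x ++ y ++ z) /\ i + m <= size (w ++ x ++ y ++ z).
Proof.
move=> [[tw tx ty tz] [hx hy hz] [w0 gx gy gz]] ri; rewrite !size_cat.
have := run_split tw _ ri; rewrite run_catE// => /(_ hx).
case: (ltnP i (size w)) => [iw|wi _].
  rewrite orbF => im; rewrite /swap_pos iw; split; last by slia.
  by rewrite (@win_mid [::] w (y ++ x ++ z) i im) (@win_mid [::] w (x ++ y ++ z) i im).
move: ri; rewrite drop_cat ltnNge wi /= => ri.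
have := run_split tx _ ri; rewrite run_catE// => /(_ hy).
case: (ltnP (i - size w) (size x)) => [ix|xi _].
  rewrite orbF => im; rewrite /swap_pos ltnNge wi /=; split; last by slia.
  have -> : i < size w + size x by slia.
  rewrite -{2}(subnKC wi) win_mid//.
  have -> : i + size y = size (w ++ y) + (i - size w) by rewrite size_cat; slia.
  by rewrite catA win_mid.
move: ri; rewrite drop_cat ltnNge xi /= => ri.
have := run_split ty hz ri.
case: (ltnP (i - size w - size x) (size y)) => [iy|yi _].
  rewrite orbF => im; rewrite /swap_pos ltnNge wi /=; split; last by slia.
  have -> : i < size w + size x = false by slia.
  have -> : i < size w + size x + size y by slia.
  have -> : i - size x = size w + (i - size w - size x) by slia.
  have {2}-> : i = size (w ++ x) + (i - size w - size x) by rewrite size_cat; slia.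
  by rewrite win_mid// [in RHS]catA win_mid.
move: ri; rewrite drop_cat ltnNge yi /= => ri.
have im : i - size w - size x - size y + m <= size z.
  by rewrite leqNgt; apply/negP => /tz/negP; apply; apply: run_leq ri; lia.
rewrite /swap_pos ltnNge wi /=; split; last by slia.
have -> : i < size w + size x = false by slia.
have -> : i < size w + size x + size y = false by slia.
set i0 := _ - size y in im ri *.
have E1 : i = size (w ++ x ++ y) + i0 by rewrite !size_cat; slia.
have E2 : i = size (w ++ y ++ x) + i0 by rewrite !size_cat; slia.
rewrite {1}E2 E1 -[z]cats0.
have -> : w ++ y ++ x ++ z ++ [::] = (w ++ y ++ x) ++ z ++ [::] by rewrite !catA.
have -> : w ++ x ++ y ++ z ++ [::] = (w ++ x ++ y) ++ z ++ [::] by rewrite !catA.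
by rewrite !win_mid.
Qed.

(** As [h <= m], a window shows whether a run of length [h] starts there. So [swap_pos] is a
    bijection between the run positions of the two words; it fixes 0 and preserves windows. *)
Lemma clean_lead_pair w x y z j : clean w x y z ->
  lead_pair h m (w ++ x ++ y ++ z) j ->
  lead_pair h m (w ++ y ++ x ++ z) (swap_pos (size w) (size x) (size y) j).
Proof.
move=> cl [jw r0 rj w0j minj]; have [_ _ [w0 _ _ _]] := cl.
have cl' := clean_sym cl.
set u := w ++ x ++ y ++ z in jw r0 rj w0j minj.
set v := w ++ y ++ x ++ z; set sw := swap_pos _ _ _.
set sw' := swap_pos (size w) (size y) (size x).
have swK : cancel sw sw' by exact: swap_posK.
have sw'K : cancel sw' sw by exact: swap_posK.
have sw0 : sw 0 = 0 by rewrite /sw /swap_pos w0.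
have winE i : run h (drop i u) -> win m (sw i) v = win m i u.
  by move=> ri; have [] := clean_run cl ri.
have winE' i : run h (drop i v) -> win m (sw' i) u = win m i v.
  by move=> ri; have [] := clean_run cl' ri.
have runE i : run h (drop i u) -> run h (drop (sw i) v).
  by move=> ri; rewrite -run_take -/(win m _ _) winE // run_take.
have runE' i : run h (drop i v) -> run h (drop (sw' i) u).
  by move=> ri; rewrite -run_take -/(win m _ _) winE' // run_take.
have h0 : 0 < h by move: g0 gh; lia.
have rj' := runE _ rj; have rd0 : run h (drop 0 u) by rewrite drop0.
split=> //.
- apply/andP; split.
    rewrite lt0n; apply/eqP => sj0; have := swK j; rewrite sj0 -{1}sw0 swK => j0.
    by rewrite -j0 in jw.
  by have := run_size rj'; rewrite size_drop; lia.
- by have := runE _ rd0; rewrite sw0 drop0.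
- by rewrite -{1}sw0 !winE.
move=> i i0 ij ri; rewrite winE// -winE'//; apply: minj; last exact: runE'.
  rewrite lt0n; apply/eqP => si0; have := sw'K i; rewrite si0 sw0 => i00.
  by rewrite -i00 in i0.
by apply/eqP => sij; have := sw'K i; rewrite sij => ji; rewrite ji eqxx in ij.
Qed.

End Transport.

(** * Counting words *)

Section Counting.
Context {d : Order.disp_t} {A : finOrderType d}.
Implicit Types (w : seq A) (P Q : pred (seq A)) (n m i j k : nat).
Local Notation q := #|A|.

Definition words n : seq (seq A) := [seq tval t | t <- enum {: n.-tuple A}].

Lemma mem_words n w : (w \in words n) = (size w == n).
Proof.
apply/mapP/idP => [[t _ ->]|wn]; first by rewrite size_tuple.
by exists (Tuple wn); rewrite ?mem_enum.
Qed.

Lemma uniq_words n : uniq (words n).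
Proof. by rewrite map_inj_uniq ?enum_uniq//; exact: val_inj. Qed.

Definition nwords n P := count P (words n).

Lemma nwords_sub n P Q : (forall w, size w = n -> P w -> Q w) ->
  nwords n P <= nwords n Q.
Proof.
move=> PQ; rewrite /nwords -!size_filter; apply: uniq_leq_size => [|w].
  by rewrite filter_uniq// uniq_words.
rewrite !mem_filter mem_words => /andP[Pw /eqP wn].
by rewrite (PQ w)// wn /=.
Qed.

Lemma nwordsU n P Q : nwords n (predU P Q) <= nwords n P + nwords n Q.
Proof. by rewrite -count_predUI leq_addr. Qed.

Lemma nwords_has n (s : seq nat) (P : nat -> pred (seq A)) B :
  (forall i, i \in s -> nwords n (P i) <= B) ->
  nwords n (fun w => has (fun i => P i w) s) <= size s * B.
Proof.
elim: s => [|i s IHs] /= PB; first by rewrite /nwords count_pred0.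
rewrite mulSn (leq_trans (nwordsU n (P i) _))// leq_add ?PB ?mem_head// IHs//.
by move=> j js; rewrite PB// in_cons js orbT.
Qed.

Lemma nwordsT n : nwords n predT = q ^ n.
Proof. by rewrite /nwords count_predT size_map -cardE card_tuple. Qed.

Lemma nwords_inj n n' (f : seq A -> seq A) P Q :
  (forall w, size w = n -> P w -> size (f w) = n' /\ Q (f w)) ->
  (forall v w, size v = n -> size w = n -> P v -> P w -> f v = f w -> v = w) ->
  nwords n P <= nwords n' Q.
Proof.
move=> fP f_inj; rewrite /nwords -!size_filter -(size_map f).
apply: uniq_leq_size.
  rewrite map_inj_in_uniq ?filter_uniq ?uniq_words// => v w.
  by rewrite !mem_filter !mem_words => /andP[? /eqP ?] /andP[? /eqP ?]; exact: f_inj.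
move=> _ /mapP[w + ->]; rewrite !mem_filter !mem_words => /andP[Pw /eqP wn].
by have [-> ->] := fP w wn Pw; rewrite eqxx.
Qed.

(** For fixed [i < j], the word is determined by what remains after deleting the window at [j]: the
    deleted letters are recovered from left to right, each being equal to the one [j - i] places
    before, even when the windows overlap. *)
Lemma nwords_dup_win m n : nwords n (dup_win m) <= n.+1 ^ 2 * q ^ (n - m).
Proof.
have nwin i j : i < j -> j + m <= n ->
    nwords n (fun w => win m i w == win m j w) <= q ^ (n - m).
  move=> ij jm; rewrite -nwordsT.
  pose f w := take j w ++ drop (j + m) w.
  apply: (@nwords_inj _ _ f) => [w wn _|v w vn wn].
    by split=> //; rewrite size_cat size_takel ?size_drop ?wn; slia.
  move=> /eqP vE /eqP wE /eqP; rewrite eqseq_cat ?size_takel; try slia.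
  move=> /andP[/eqP tE /eqP dE].
  have [x _] : exists x : A, x \in v.
    case: v vn {vE tE dE} => [/= n0|x v _]; first by slia.
    by exists x; rewrite mem_head.
  apply: (@eq_from_nth _ x); first by rewrite vn wn.
  move=> k; have [l] := ubnP k; elim: l k => // l IH k kl kv.
  have [kj|jk] := ltnP k j; first by rewrite -(nth_take x kj) tE nth_take.
  have [kjm|jmk] := ltnP k (j + m); last first.
    by rewrite -(subnKC jmk) -!nth_drop dE.
  have nth_win u : win m i u = win m j u -> nth x u k = nth x u (k - (j - i)).
    move=> /(congr1 (fun s => nth x s (k - j))).
    rewrite !nth_take ?nth_drop; try slia.
    have -> : j + (k - j) = k by lia.
    by have -> : i + (k - j) = k - (j - i) by lia.
  by rewrite (nth_win v)// (nth_win w)//; apply: IH; slia.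
rewrite /dup_win.
pose P j w := has (fun i => win m i w == win m j w) (iota 0 j).
apply: (@leq_trans (nwords n (fun w => has (P^~ w) (iota 0 (n - m).+1)))).
  by apply: nwords_sub => w ->.
rewrite -mulnn -mulnA.
apply: leq_trans (nwords_has (B := n.+1 * q ^ (n - m)) _) _; last first.
  by rewrite size_iota leq_mul2r; apply/orP; right; lia.
move=> j; rewrite mem_iota => jn.
apply: leq_trans (nwords_has (B := q ^ (n - m)) _) _; last first.
  by rewrite size_iota leq_mul2r; apply/orP; right; lia.
by move=> i; rewrite mem_iota => ij; apply: nwin; lia.
Qed.

Variable a : A.
Local Notation run := (run a).

Lemma nwords_two_runs n k l i : k <= i -> i + l <= n ->
  nwords n (fun w => run k w && run l (drop i w)) <= q ^ (n - (k + l)).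
Proof.
move=> ki il; rewrite -nwordsT.
pose f w := drop k (take i w) ++ drop (i + l) w.
apply: (@nwords_inj _ _ f) => [w wn _|v w vn wn].
  by split=> //; rewrite size_cat !size_drop size_takel wn; slia.
move=> /andP[/eqP vk /eqP vl] /andP[/eqP wk /eqP wl] /eqP.
rewrite eqseq_cat ?size_drop ?size_takel; try slia.
move=> /andP[/eqP tE /eqP dE].
rewrite -(cat_take_drop i v) -(cat_take_drop i w).
rewrite -(cat_take_drop l (drop i v)) -(cat_take_drop l (drop i w)) vl wl.
rewrite !drop_drop addnC dE; congr (_ ++ _).
rewrite -(cat_take_drop k (take i v)) -(cat_take_drop k (take i w)) tE.
by rewrite !take_takel// vk wk.
Qed.

Lemma nwords_runs n k l i : 0 < l -> k <= i ->
  nwords n (fun w => run k w && run l (drop i w)) <= q ^ (n - (k + l)).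
Proof.
move=> l0 ki; have [il|il] := leqP (i + l) n; first exact: nwords_two_runs.
apply: leq_trans (nwords_sub (Q := pred0) _) _; last by rewrite /nwords count_pred0.
by move=> w wn /andP[_ /run_size]; rewrite size_drop wn; clear -l0 il; lia.
Qed.

Definition no_run k w := ~~ has (fun i => run k (drop i w)) (iota 0 (size w)).

Lemma nwords_catl k l P Q :
  nwords (k + l) (fun w => P (take k w) && Q (drop k w)) <=
  nwords k P * nwords l Q.
Proof.
rewrite /nwords -!size_filter -(size_allpairs cat); apply: uniq_leq_size.
  by rewrite filter_uniq// uniq_words.
move=> w; rewrite mem_filter mem_words => /andP[/andP[Pw Qw] /eqP wn].
apply/allpairsP; exists (take k w, drop k w); rewrite !mem_filter !mem_words /=.
by rewrite Pw Qw cat_take_drop size_drop size_takel wn ?leq_addr// addKn !eqxx.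
Qed.

(** Cut the word into [n %/ k] blocks of length [k] and a remainder: no block is [a^k]. *)
Lemma nwords_no_run k n : 0 < k ->
  nwords n (no_run k) <= (q ^ k - 1) ^ (n %/ k) * q ^ (n %% k).
Proof.
move=> k0; rewrite {1}(divn_eq n k); elim: (n %/ k) => [|b IH].
  by rewrite mul0n add0n mul1n -nwordsT; apply: nwords_sub.
rewrite mulSn expnS -mulnA; apply: leq_trans (leq_mul (leqnn _) IH) => {IH}.
set l := b * k + _; rewrite -addnA -/l.
have Ek : nwords k (fun w => ~~ run k w) <= q ^ k - 1.
  rewrite -nwordsT leq_subRL; last first.
    by rewrite -has_count; apply/hasP; exists (nseq k a); rewrite ?mem_words ?size_nseq.
  rewrite /nwords count_predT -(count_predC (run k)) leq_add2r -has_count.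
  apply/hasP; exists (nseq k a); rewrite ?mem_words ?size_nseq//.
  by rewrite !runE take_oversize ?size_nseq.
apply: leq_trans (leq_mul Ek (leqnn _)).
apply: leq_trans (nwords_catl _ _ _ _).
apply: nwords_sub => w wn /hasPn H; apply/andP; split.
  have /H : 0 \in iota 0 (size w) by rewrite mem_iota; lia.
  by rewrite drop0; apply: contra; rewrite !runE take_takel.
apply/hasPn => i; rewrite mem_iota size_drop drop_drop => iw.
by apply: H; rewrite mem_iota; slia.
Qed.

(** The [n] rotations of all Lyndon words are pairwise distinct: if two distinct Lyndon words were
    rotations of each other, or one a nontrivial rotation of itself, each would be strictly below
    the other. *)
Lemma nwords_lyndon_le n : n * nwords n lyndon <= q ^ n.
Proof.
rewrite -nwordsT /nwords count_predT mulnC -size_filter -[X in _ * X](size_iota 0 n).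
rewrite -(size_allpairs (fun w i => rot i w)); apply: uniq_leq_size; last first.
  move=> _ /allpairsP[[w i] /= [+ _ ->]].
  by rewrite mem_filter !mem_words size_rot => /andP[].
apply: allpairs_uniq; rewrite ?iota_uniq ?filter_uniq ?uniq_words//.
have key v w i j : i <= j -> j < n -> size v = n -> size w = n ->
    lyndon v -> lyndon w -> rot i v = rot j w -> v = w /\ i = j.
  move=> ij jn vn wn lv lw; rewrite -(subnKC ij) rotD ?wn; last by lia.
  move=> /rot_inj vE; have [ji|ji] := posnP (j - i).
    by rewrite ji rot0 in vE; split=> //; lia.
  have /(lyndon_rot_gt lw) : 0 < j - i < size w by slia.
  have /(lyndon_rot_gt lv) : 0 < size v - (j - i) < size v by slia.
  have -> : rot (size v - (j - i)) v = w by rewrite -/(rotr _ v) vE rotK.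
  by rewrite -vE => vw wv; have := lt_trans vw wv; rewrite ltxx.
move=> [v i] [w j] /allpairsP[[v' i'] /= [+ + [-> ->]]].
rewrite mem_filter mem_words mem_iota => /andP[lv /eqP vn] iN.
move=> /allpairsP[[w' j'] /= [+ + [-> ->]]].
rewrite mem_filter mem_words mem_iota => /andP[lw /eqP wn] jN E.
have [ij|/ltnW ji] := leqP i' j'.
  by have [|-> ->] := key v' w' i' j' ij _ vn wn lv lw E.
by have [|-> ->] := key w' v' j' i' ji _ wn vn lw lv (esym E).
Qed.

(** A word without repeated window is primitive: if [rot k w = w], the windows at 0 and [k], or at 0
    and [n - k], coincide, and one of these fits since [2 m <= n]. Its least rotation is then
    strictly least, hence Lyndon. *)
Lemma nwords_lyndon_ge n m : 0 < n -> m.*2 <= n ->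
  q ^ n <= n * nwords n lyndon + nwords n (dup_win m).
Proof.
move=> n0 mn; rewrite -nwordsT addnC -leq_subLR.
have -> : nwords n predT - nwords n (dup_win m) = nwords n (fun w => ~~ dup_win m w).
  by rewrite /nwords count_predT -(count_predC (dup_win m)) addKn.
rewrite /nwords mulnC -!size_filter -[X in _ * X](size_iota 0 n).
rewrite -(size_allpairs (fun w i => rot i w)); apply: uniq_leq_size.
  by rewrite filter_uniq// uniq_words.
move=> w; rewrite mem_filter mem_words => /andP[dw /eqP wn].
have rot_win k : 0 < k -> k + m <= n -> rot k w != w.
  move=> k0 km; apply/eqP => rw.
  have : win m 0 w != win m k w by apply: (dup_winPn dw); rewrite ?wn.
  rewrite /win drop0 -{1}rw /rot takel_cat ?eqxx// size_drop; slia.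
have rot_neq k : 0 < k < n -> rot k w != w.
  move=> kn; have [km|mk] := leqP (k + m) n; first by apply: rot_win; lia.
  apply/eqP => rw; have /eqP[] : rot (n - k) w != w by apply: rot_win; lia.
  by have := rotK k w; rewrite /rotr size_rot rw wn.
have [i _ imin] : exists2 i : 'I_n, true & forall k : 'I_n, (rot i w <= rot k w)%O.
  have := arg_minP (fun i : 'I_n => rot i w) (i0 := Ordinal n0) (P := xpredT) isT.
  by case=> i _ H; exists i => // k; apply: H.
have rn : rot n w = w by rewrite -wn rot_size.
have li : lyndon (rot i w).
  apply: rot_min_lyndon => k; rewrite size_rot wn => kn.
  rewrite lt_neqAle; apply/andP; split.
    rewrite rot_rot eq_sym; apply: contra (rot_neq k kn) => /eqP/rot_inj ->.
    by rewrite eqxx.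
  have in_ := ltn_ord i; rewrite rot_add_mod ?wn; try lia.
  case: (ltngtP (k + i) n) => kin.
  - exact: (imin (Ordinal kin)).
  - have kin' : k + i - n < n by lia.
    exact: (imin (Ordinal kin')).
  - by have := imin (Ordinal n0); rewrite ?kin /= rot0 -{2}rn.
(* The inverse rotation; the remainder handles [i = 0]. *)
apply/allpairsP; exists (rot i w, (n - i) %% n) => /=.
rewrite mem_filter mem_words size_rot wn eqxx li mem_iota ltn_mod n0; split=> //.
have [i0|i0] := posnP i; first by rewrite i0 subn0 modnn !rot0.
rewrite modn_small; last by have := ltn_ord i; lia.
by have := rotK i w; rewrite /rotr size_rot wn.
Qed.
End Counting.

(** * The position of the standard right factor is almost equidistributed *)

Section Flatness.
Context {d : Order.disp_t} {A : finOrderType d} (a : A).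
Hypothesis a_min : forall x, (a <= x)%O.
Implicit Types (p r w x y z : seq A) (S : pred nat) (i j k l u v : nat).
Local Notation run := (run a).
Local Notation no_run := (no_run a).
Local Notation q := #|A|.

Variables (n h g m : nat).
Hypotheses (g0 : 0 < g) (gh : g.*2 <= h.+1) (hm : h < m).

Let gm : g <= m. Proof. by move: gh hm; lia. Qed.

Lemma tail_free_mid p r s w : w = p ++ r ++ s -> m <= size r ->
  (forall i, size (p ++ r) < i + m -> i <= size (p ++ r) -> ~~ run g (drop i w)) ->
  tail_free a g m r.
Proof.
move=> wE mr H i ri; apply/negP => gi.
have ir : i <= size r by have := run_size gi; rewrite size_drop; lia.
have /negP : ~~ run g (drop (size p + i) w) by apply: H; rewrite size_cat; lia.
rewrite wE drop_cat ltnNge leq_addr /= addKn drop_cat; apply.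
case: ltnP => [_|ri']; first exact: run_catl.
by have := run_size gi; rewrite size_drop; lia.
Qed.

(** A run at the end or the start of a piece is a run of the whole word, so it suffices to exclude
    starts in [(c - m, c]] for each cut [c], the end of the word included. *)
Lemma clean_intro w x y z : m <= size w -> m <= size x -> m <= size y ->
  m <= size z ->
  (forall c i, c \in [:: size w; size (w ++ x); size (w ++ x ++ y);
                         size (w ++ x ++ y ++ z)] ->
     c < i + m -> i <= c -> ~~ run g (drop i (w ++ x ++ y ++ z))) ->
  clean a g m w x y z.
Proof.
move=> mw mx my mz H; split; [split|split|split]; try (by move: hm gm; lia).
- apply: (@tail_free_mid [::] w (x ++ y ++ z) _ erefl mw) => i; apply: H.
  by rewrite mem_head.
- apply: (@tail_free_mid w x (y ++ z) _ erefl mx) => i; apply: H.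
  by rewrite !in_cons eqxx orbT.
- apply: (@tail_free_mid (w ++ x) y z (w ++ x ++ y ++ z)) => //.
    by rewrite !catA.
  by move=> i; rewrite -catA; apply: H; rewrite !in_cons eqxx !orbT.
- apply: (@tail_free_mid (w ++ x ++ y) z [::] (w ++ x ++ y ++ z)) => //.
    by rewrite cats0 !catA.
  by move=> i; rewrite -!catA; apply: H; rewrite !in_cons eqxx !orbT.
- have := H (size w) (size w); rewrite mem_head => /(_ isT).
  have -> : size w < size w + m by move: gm; lia.
  rewrite leqnn drop_size_cat// => /(_ isT isT); apply: contra; exact: run_catl.
- have := H (size (w ++ x)) (size (w ++ x)); rewrite !in_cons eqxx orbT => /(_ isT).
  have -> : size (w ++ x) < size (w ++ x) + m by move: gm; lia.
  rewrite leqnn catA drop_size_cat// => /(_ isT isT); apply: contra; exact: run_catl.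
- have := H (size (w ++ x ++ y)) (size (w ++ x ++ y)).
  rewrite !in_cons eqxx !orbT => /(_ isT).
  have -> : size (w ++ x ++ y) < size (w ++ x ++ y) + m by move: gm; lia.
  rewrite leqnn => /(_ isT isT).
  by rewrite (_ : w ++ x ++ y ++ z = (w ++ x ++ y) ++ z) ?drop_size_cat// -!catA.
Qed.

Definition swap_word c u v w := take c w ++ take v (drop (c + u) w) ++
  take u (drop c w) ++ drop (c + u + v) w.

Lemma cut_word c u v w : w = take c w ++ take u (drop c w) ++
  take v (drop (c + u) w) ++ drop (c + u + v) w.
Proof.
by rewrite -(addnC u c) -(addnC v (u + c)) -!drop_drop !cat_take_drop.
Qed.

Lemma size_swap_word c u v w : size (swap_word c u v w) = size w.
Proof. by rewrite [in RHS](cut_word c u v w) /swap_word !size_cat; lia. Qed.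

Lemma swap_word_cat p x y z :
  swap_word (size p) (size x) (size y) (p ++ x ++ y ++ z) = p ++ y ++ x ++ z.
Proof.
rewrite /swap_word (take_size_cat _ (erefl (size p))).
rewrite (drop_size_cat _ (erefl (size p))) (take_size_cat _ (erefl (size x))).
have -> : drop (size p + size x) (p ++ x ++ y ++ z) = y ++ z.
  by rewrite -size_cat catA drop_size_cat.
rewrite (take_size_cat _ (erefl (size y))); do 3 congr (_ ++ _).
rewrite -addnA -size_cat -size_cat.
by rewrite (_ : p ++ x ++ y ++ z = (p ++ x ++ y) ++ z) ?drop_size_cat// -!catA.
Qed.

Lemma swap_wordK c u v w : c + u + v <= size w ->
  swap_word c v u (swap_word c u v w) = w.
Proof.
move=> cw; have sp : size (take c w) = c by rewrite size_takel//; slia.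
have sx : size (take u (drop c w)) = u by rewrite size_takel// size_drop; slia.
have sy : size (take v (drop (c + u) w)) = v.
  by rewrite size_takel// size_drop; slia.
have := swap_word_cat (take c w) (take v (drop (c + u) w)) (take u (drop c w))
  (drop (c + u + v) w).
by rewrite sp sx sy => ->; rewrite -cut_word.
Qed.

(** The starts in [(c - m, c]] for the three cuts and the end of the word. The margins of [2 m] keep
    them beyond [m > h], disjoint from the run at 0. *)
Definition cuts u :=
  [seq c - m + i | c <- [:: m.*2; m.*2 + u; n - m.*2; n], i <- iota 1 m].

(** Runs at the cuts are counted only together with the initial run: both cost a factor
    [q^-(h + 1 + g)], small enough for a union over the [4 m] positions. A Lyndon word with a long
    run does start with one. *)
Definition bad u w := [|| no_run h.+1 w, dup_win m w |
  has (fun i => run h.+1 w && run g (drop i w)) (cuts u)].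

Lemma nwords_bad u : u + m.*2 + m.*2 <= n ->
  nwords n (bad u) <= nwords n (no_run h.+1) + n.+1 ^ 2 * q ^ (n - m) +
    4 * m * q ^ (n - (h.+1 + g)).
Proof.
move=> un; apply: leq_trans (nwordsU n (no_run h.+1) _) _.
rewrite -addnA leq_add2l; apply: leq_trans (nwordsU n (dup_win m) _) _.
apply: leq_add; first exact: nwords_dup_win.
apply: leq_trans (nwords_has (B := q ^ (n - (h.+1 + g))) _) _; last first.
  by rewrite /cuts size_allpairs size_iota.
move=> i /allpairsP[[c j] /= [cin + ->]]; rewrite mem_iota => jm.
apply: nwords_runs => //; move: cin; rewrite !inE => /or4P[] /eqP ->; lia.
Qed.

(** The word is cut as [p ++ x ++ y ++ z] with margins [p] and [z] of length [2 m]. The new word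
    still ends with [z], so its last letter is still not [a] and [lead_pair_lyndon] applies. *)
Lemma lyndon_swap u v w : size w = n -> m <= u -> m <= v ->
  u + v + 4 * m = n -> lyndon w -> 1 < std_pos w -> ~~ bad u w ->
  lyndon (swap_word m.*2 u v w) /\
  std_pos (swap_word m.*2 u v w) = swap_pos m.*2 u v (std_pos w).
Proof.
move=> wn mu mv uv lw j1; rewrite /bad 2!negb_or negbK => /and3P[/hasP[i iw ri] dw hc].
have n1 : 1 < size w by rewrite wn; move: g0 gh hm uv; clear; lia.
have rw := lyndon_run a_min n1 lw ri.
have cw : m.*2 + u + v <= size w by slia.
set p := take m.*2 w; set x := take u (drop m.*2 w).
set y := take v (drop (m.*2 + u) w); set z := drop (m.*2 + u + v) w.
have sp : size p = m.*2 by rewrite size_takel//; slia.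
have sx : size x = u by rewrite size_takel// size_drop; slia.
have sy : size y = v by rewrite size_takel// size_drop; slia.
have sz : size z = m.*2 by rewrite size_drop; slia.
have wE : w = p ++ x ++ y ++ z by exact: cut_word.
have cl : clean a g m p x y z.
  apply: clean_intro; rewrite ?sp ?sx ?sy ?sz; try (by move: mu mv; lia).
  move=> c j cin cj jc; rewrite -wE; apply: contra hc => gj.
  apply/hasP; exists j; last by rewrite rw.
  apply/allpairsP; exists (c, j - (c - m)); split.
  - move: cin; rewrite !size_cat sp sx sy sz !inE.
    rewrite (_ : m.*2 + (u + v) = n - m.*2); last by move: uv; lia.
    by rewrite (_ : m.*2 + (u + (v + m.*2)) = n); last by move: uv; lia.
  - rewrite mem_iota /=; move: cin; rewrite !size_cat sp sx sy sz !inE.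
    by move=> /or4P[] /eqP cE; move: cE cj jc uv; lia.
  - by rewrite /=; lia.
have lead : lead_pair a h m w (std_pos w).
  apply: lyndon_lead_pair => //; first by lia.
  by move=> j; rewrite wE => rj; have [] := clean_run g0 gh (ltnW hm) cl rj.
rewrite wE in lead; have := clean_lead_pair g0 gh (ltnW hm) cl lead.
rewrite -wE /swap_word -/p -/x -/y -/z sp sx sy.
apply: lead_pair_lyndon => //.
have := lyndon_last a_min n1 lw; rewrite {1}wE !last_cat.
have : 0 < size z by rewrite sz; lia.
by case: (z).
Qed.

Lemma nwords_swap u v S S' : m <= u -> m <= v -> u + v + 4 * m = n ->
  (forall j, S j -> 1 < j /\ S' (swap_pos m.*2 u v j)) ->
  nwords n (fun w => lyndon w && S (std_pos w)) <=
  nwords n (fun w => lyndon w && S' (std_pos w)) + nwords n (bad u).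
Proof.
move=> mu mv uv SS'.
set P := fun w => lyndon w && S (std_pos w).
apply: (@leq_trans (nwords n (predU (predI P (predC (bad u))) (bad u)))).
  by apply: nwords_sub => w _ /= ->; case: bad.
apply: leq_trans (nwordsU _ _ _) _; rewrite leq_add2r.
apply: (@nwords_inj _ _ _ _ (swap_word m.*2 u v)) => [w wn|w w' wn wn' _ _ ww'].
  move=> /andP[/andP[lw Sj] /= bw]; have [j1 Sj'] := SS' _ Sj.
  by rewrite size_swap_word; have [-> ->] := lyndon_swap wn mu mv uv lw j1 bw.
rewrite -(@swap_wordK m.*2 u v w) ?ww' ?swap_wordK//; slia.
Qed.

Definition block l b j := m.*2 + b * l <= j < m.*2 + b.+1 * l.

Lemma nwords_block k l b c B : b < k -> c < k -> m <= l -> k * l + 4 * m <= n ->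
  (forall u, u + m.*2 + m.*2 <= n -> nwords n (bad u) <= B) ->
  nwords n (fun w => lyndon w && block l b (std_pos w)) <=
  nwords n (fun w => lyndon w && block l c (std_pos w)) + B.
Proof.
move=> bk ck ml kl HB.
have bl : b.+1 * l <= k * l by rewrite leq_mul2r bk orbT.
have cl : c.+1 * l <= k * l by rewrite leq_mul2r ck orbT.
case: (ltngtP b c) => [bc|cb|->]; last by rewrite leq_addr.
- have le1 : 1 * l <= (c - b) * l by rewrite leq_mul2r; apply/orP; right; lia.
  have e1 : (c - b) * l + b * l = c * l by rewrite -mulnDl subnK// ltnW.
  (* Block [b] lies in the first exchanged factor, which moves right by the length [(c - b) * l] of
     the second. *)
  have := @nwords_swap (n - 4 * m - (c - b) * l) ((c - b) * l)
    (block l b) (block l c).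
  rewrite !mulSn in bl cl e1 le1 * => H.
  apply: leq_trans (H _ _ _ _) _; try lia; last first.
    by rewrite leq_add2l; apply: HB; lia.
  move=> j; rewrite /block !mulSn /swap_pos => jb; split; first by lia.
  by rewrite ifF ?ifT; lia.
have le1 : 1 * l <= (b - c) * l by rewrite leq_mul2r; apply/orP; right; lia.
have e1 : (b - c) * l + c * l = b * l by rewrite -mulnDl subnK// ltnW.
(* Block [b] lies in the second exchanged factor, which moves left by the length [(b - c) * l] of
   the first. *)
have := @nwords_swap ((b - c) * l) (n - 4 * m - (b - c) * l)
  (block l b) (block l c).
rewrite !mulSn in bl cl e1 le1 * => H.
apply: leq_trans (H _ _ _ _) _; try lia; last first.
  by rewrite leq_add2l; apply: HB; lia.
move=> j; rewrite /block !mulSn /swap_pos => jb; split; first by lia.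
by rewrite ifF; [rewrite ifF; [rewrite ifT|]|]; lia.
Qed.

End Flatness.

(** * Positions near the ends, and position 1 *)

Section Extremes.
Context {d : Order.disp_t} {A : finOrderType d} (a : A).
Hypothesis a_min : forall x, (a <= x)%O.
Implicit Types (v w : seq A) (h i k n : nat).
Local Notation run := (run a).
Local Notation no_run := (no_run a).
Local Notation q := #|A|.

(** Each of the [l + k] positions forces two disjoint runs, of lengths [h + 1] and [h]. *)
Lemma nwords_ends n h l k : 1 < n -> 0 < h ->
  nwords n (fun w => [&& lyndon w, 1 < std_pos w &
                      (std_pos w < l) || (n - k <= std_pos w)]) <=
  nwords n (no_run h.+1) + (l + k) * q ^ (n - (h.+1 + h)).
Proof.
move=> n1 h0; set P := fun w => _.
pose s := [seq i <- iota 0 l ++ iota (n - k) k | h < i].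
pose Q := fun w => has (fun i => run h.+1 w && run h (drop i w)) s.
apply: (@leq_trans (nwords n (predU (no_run h.+1) Q))).
  apply: nwords_sub => w wn /and3P[lw j1 jlk] /=.
  case: (boolP (no_run _ _)) => //=; rewrite negbK => /hasP[i _ ri].
  have w1 : 1 < size w by rewrite wn.
  have rw := lyndon_run a_min w1 lw ri.
  have [rj hj] := lyndon_std_pos_run a_min w1 lw rw j1.
  apply/hasP; exists (std_pos w); last by rewrite rw.
  rewrite mem_filter hj mem_cat !mem_iota /=.
  have [/andP[_ jn] _ _] := std_posP w1; move: jn jlk; rewrite wn.
  by move: (std_pos w) => j; lia.
apply: leq_trans (nwordsU _ _ _) _; rewrite leq_add2l.
apply: leq_trans (nwords_has (B := q ^ (n - (h.+1 + h))) _) _; last first.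
  rewrite leq_mul2r; apply/orP; right.
  by rewrite size_filter (leq_trans (count_size _ _))// size_cat !size_iota.
by move=> i; rewrite mem_filter => /andP[hi _]; exact: nwords_runs.
Qed.

(** If [v] starts with a letter above [a], then [a :: v < v] at once; if [v = a :: v'], it reduces
    to [v < v'], which holds as [v] is Lyndon and [v'] nonempty. *)
Lemma cons_lyndon v : 1 < size v -> lyndon v -> lyndon (a :: v) /\ std_pos (a :: v) = 1.
Proof.
move=> v1 lv; have lav : (a :: v < v)%O.
  case: v v1 lv => // x v v1 /lyndonP lv.
  have := a_min x; rewrite le_eqVlt => /predU1P[ax|ax]; last first.
    by rewrite neqhead_ltxiE// lt_eqF.
  by rewrite ax eqhead_ltxiE; have := lv 1; rewrite drop1; apply.
have minv i : 0 < i < size (a :: v) -> (v <= drop i (a :: v))%O.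
  case: i => // i iv; have [->|i0] := posnP i; first by rewrite drop1.
  by apply/ltW/(lyndonP _ lv); move: iv; rewrite /= i0.
split; first by apply/lyndonP => i iv; exact: lt_le_trans lav (minv i iv).
apply: std_pos_unique => [|i iv]; first by rewrite /=; lia.
by rewrite drop1 minv.
Qed.

Lemma nwords_one_ge n : 1 < n ->
  nwords n (@lyndon _ A) <= nwords n.+1 (fun w => lyndon w && (std_pos w == 1)).
Proof.
move=> n1; apply: (@nwords_inj _ _ _ _ (cons a)) => [w wn lw|v w _ _ _ _ []//].
have [|-> ->] := @cons_lyndon w _ lw; first by rewrite wn.
by rewrite /= wn eqxx.
Qed.

(** The tail is Lyndon, being the least proper suffix. Deleting the first letter is injective once
    this letter is known to be [a], which a long run ensures. *)
Lemma nwords_one_le n h : 0 < n ->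
  nwords n.+1 (fun w => lyndon w && (std_pos w == 1)) <=
  nwords n.+1 (no_run h.+1) + nwords n (@lyndon _ A).
Proof.
move=> n0; set P := fun w => _.
apply: (@leq_trans (nwords n.+1 (predU (no_run h.+1) (predI P (run 1))))).
  apply: nwords_sub => w wn /= Pw; rewrite Pw /=.
  case: (boolP (no_run _ _)) => //=; rewrite negbK => /hasP[i _ ri].
  move: Pw => /andP[lw _]; have w1 : 1 < size w by rewrite wn; lia.
  exact: run_leq (lyndon_run a_min w1 lw ri).
apply: leq_trans (nwordsU _ _ _) _; rewrite leq_add2l.
apply: (@nwords_inj _ _ _ _ behead) => [w wn|v w].
  move=> /andP[/andP[lw /eqP j1] _]; rewrite size_behead wn; split=> //.
  have w1 : 1 < size w by rewrite wn.
  have [_ _ minj] := std_posP w1; rewrite j1 drop1 in minj.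
  apply/lyndonP => i iw; rewrite -[behead w]drop1 drop_drop addn1 lt_neqAle.
  rewrite drop1 minj ?andbT; last by move: iw; rewrite size_behead wn; lia.
  apply/eqP => /(congr1 size); rewrite size_behead size_drop wn.
  by move: iw; rewrite size_behead wn; lia.
case: v w => [|x v] [|y w] //= _ _ /andP[_ rx] /andP[_ ry] ->.
by move: rx ry; rewrite !runS => /andP[/eqP -> _] /andP[/eqP -> _].
Qed.

End Extremes.

(** * Scales *)

Section Scales.
Implicit Types (b k n t : nat).

(** Bernoulli's inequality [1 + b / X <= (1 + 1 / X)^b], cleared of denominators. *)
Lemma bernoulli_exp (X b : nat) : X ^ b * (X + b) <= X.+1 ^ b * X.
Proof.
elim: b => [|b IH]; first by rewrite !mul1n addn0.
have le : X ^ b <= X.+1 ^ b by case: b {IH} => // b; rewrite leq_exp2r.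
rewrite !expnS; nia.
Qed.

(** A polynomial substitute for the exponential decay of [(1 - 1 / X)^c]: it is at most
    [(1 + 1 / X)^(- 6 b)] because [(X - 1) (X + 1) <= X^2], hence at most [(X / (X + b))^6]. *)
Lemma pred_exp_bound (X b c : nat) : 0 < X -> 6 * b <= c ->
  (X - 1) ^ c * (X + b) ^ 6 <= X ^ (c + 6).
Proof.
move=> X0 bc; rewrite -(@leq_pmul2r (X ^ (b * 6))) ?expn_gt0 ?X0//.
have -> : (X - 1) ^ c * (X + b) ^ 6 * X ^ (b * 6) =
    (X - 1) ^ c * (X ^ b * (X + b)) ^ 6.
  by rewrite expnMn -expnM -mulnA [X in _ * X]mulnC.
apply: (@leq_trans ((X - 1) ^ c * (X.+1 ^ b * X) ^ 6)).
  by rewrite leq_mul2l; apply/orP; right; rewrite leq_exp2r// bernoulli_exp.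
rewrite expnMn -expnM -{1}(subnKC bc) expnD.
have sq : ((X - 1) * X.+1) ^ (6 * b) <= X ^ (6 * b) * X ^ (6 * b).
  rewrite -expnMn; have [->//|b0] := posnP (6 * b); rewrite leq_exp2r//; nia.
have le : (X - 1) ^ (c - 6 * b) <= X ^ (c - 6 * b).
  by have [->//|b0] := posnP (c - 6 * b); rewrite leq_exp2r//; lia.
have -> : X ^ (c + 6) * X ^ (b * 6) =
    X ^ (c - 6 * b) * (X ^ (6 * b) * X ^ (6 * b)) * X ^ 6.
  by rewrite -!expnD; congr (_ ^ _); lia.
have -> : (X - 1) ^ (6 * b) * (X - 1) ^ (c - 6 * b) * (X.+1 ^ (b * 6) * X ^ 6) =
    (X - 1) ^ (c - 6 * b) * ((X - 1) * X.+1) ^ (6 * b) * X ^ 6.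
  by rewrite expnMn (mulnC b 6); ring.
by rewrite leq_mul2r leq_mul ?orbT.
Qed.

Variable q : nat.
Hypothesis q1 : 1 < q.

(* With [t = scale n], so that [q^(16 t) <= n < q^(16 (t + 1))], the lengths are
   [h = 12 t], [g = 6 t] and [m = 64 t]: the exceptional sets are negligible since
   [16 < 12 + 6] (runs at the cuts), [16 < 12 + 12] (runs near the ends),
   [3 * 16 < 64] (repeated factors) and [12 < 16] (no long run). *)
Definition scale n := trunc_log (q ^ 16) n.

Lemma scale_bounds n : 0 < n ->
  (q ^ scale n) ^ 16 <= n /\ n.+1 <= q ^ 16 * (q ^ scale n) ^ 16.
Proof.
move=> n0; have q16 : 1 < q ^ 16 by rewrite -(exp1n 16) ltn_exp2r.
have /andP[le lt] := trunc_log_bounds q16 n0.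
by rewrite -!expnM mulnC expnM; split=> //; rewrite -expnS.
Qed.

Lemma leq_scale k n : (q ^ 16) ^ k <= n -> k <= scale n.
Proof. by apply: trunc_log_max; rewrite -(exp1n 16) ltn_exp2r. Qed.

Lemma scale_leq n : scale n <= q ^ scale n.
Proof. by apply/ltnW/ltn_expl. Qed.

Definition no_run_bound n (H : nat) := (q ^ H - 1) ^ (n %/ H) * q ^ (n %% H).

(** Up to constants, [X] is [Q^12], [n] is [Q^16], and [X + b] is at least [n / Q], that is [Q^15].
    With exponent [e] in [pred_exp_bound] one needs [17 + 12 e <= 15 e], and 6 is the least such
    integer (89 against 90). *)
Lemma no_run_bound_small n t : t = scale n -> 0 < t ->
  n * no_run_bound n (12 * t).+1 * q ^ t <= 78 ^ 6 * q ^ 22 * q ^ n.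
Proof.
move=> tE t0; set H := (12 * t).+1; set Q := q ^ t; set X := q ^ H.
have n0 : 0 < n by case: n tE => // tE; rewrite tE /scale trunc_log0 in t0.
have [Qn nQ] := scale_bounds n0; rewrite -tE -/Q in Qn nQ.
have tQ : t <= Q by rewrite /Q tE; exact: scale_leq.
have X0 : 0 < X by rewrite expn_gt0; lia.
have Q0 : 0 < Q by rewrite expn_gt0; lia.
set c := n %/ H; set b := c %/ 6.
have XE : X = q * Q ^ 12 by rewrite /X /H expnS /Q -expnM (mulnC t).
have qn : q ^ n = X ^ c * q ^ (n %% H).
  by rewrite -expnM -expnD mulnC -divn_eq.
rewrite /no_run_bound -/H -/X -/c qn.
have Qt : Q ^ 89 <= Q ^ 90 by rewrite leq_pexp2l.
clearbody X Q.
have bc : 6 * b <= c by rewrite mulnC leq_divM.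
have main := pred_exp_bound X0 bc.
(* Here [78 = 13 * 6], from [H <= 13 Q] and [c + 1 <= 6 (b + 1)]. *)
have nb : n <= 78 * Q * (X + b).
  have h1 : n < H * c.+1 by rewrite mulnC; apply: ltn_ceil.
  have h2 : c.+1 <= 6 * b.+1 by rewrite mulnC; apply: ltn_ceil.
  have h3 : H <= 13 * Q by rewrite /H; clear -t0 tQ; lia.
  have h4 : b.+1 <= X + b by rewrite -add1n leq_add2r.
  apply: (@leq_trans (13 * Q * (6 * (X + b)))); last by clear; lia.
  apply: leq_trans (ltnW h1) _; apply: leq_mul => //.
  by apply: leq_trans h2 _; rewrite leq_mul2l.
have key : Q ^ 90 <= 78 ^ 6 * (X + b) ^ 6.
  have h : (Q ^ 16) ^ 6 <= (78 * Q * (X + b)) ^ 6.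
    by rewrite leq_exp2r//; exact: leq_trans nb.
  rewrite -expnM (expnMn (78 * Q)) (expnMn 78) in h.
  rewrite -(@leq_pmul2l (Q ^ 6)) ?expn_gt0 ?Q0// -expnD.
  by apply: leq_trans h _; rewrite mulnA (mulnC (78 ^ 6)).
move: (78 ^ 6) key => K key.
rewrite (_ : n * _ * Q = (n * (X - 1) ^ c * Q) * q ^ (n %% H)); last by ring.
rewrite mulnA leq_mul2r; apply/orP; right.
rewrite -(@leq_pmul2r ((X + b) ^ 6)) ?expn_gt0 ?addn_gt0 ?X0//.
rewrite (_ : n * _ * Q * _ = (n * Q) * ((X - 1) ^ c * (X + b) ^ 6)); last by ring.
apply: leq_trans (leq_mul (leqnn _) main) _.
rewrite expnD (_ : _ * (X ^ c * X ^ 6) = n * Q * X ^ 6 * X ^ c); last by ring.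
rewrite (_ : K * _ * _ * _ = q ^ 22 * (K * (X + b) ^ 6) * X ^ c); last by ring.
rewrite leq_mul2r; apply/orP; right.
apply: leq_trans (leq_mul (leqnn _) key).
apply: (@leq_trans ((q ^ 16 * Q ^ 16) * Q * X ^ 6)).
  by rewrite !leq_mul2r (ltnW nQ) !orbT.
rewrite XE expnMn -expnM.
rewrite (_ : q ^ 16 * _ * Q * _ = q ^ 22 * Q ^ 89); last first.
  by rewrite (expnD q 16 6) (expnD Q (16 + 1) (12 * 6)) (expnD Q 16 1) expn1; ring.
by rewrite leq_mul2l Qt orbT.
Qed.

Lemma scale_room n k : 0 < scale n -> k <= scale n -> k * (64 * scale n) <= n.
Proof.
move=> t0 kt; have n0 : 0 < n by case: n t0 {kt} => //; rewrite /scale trunc_log0.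
have [Qn _] := scale_bounds n0; have tQ := scale_leq n.
set t := scale n in t0 kt Qn tQ *; set Q := q ^ t in Qn tQ.
have Q2 : 2 <= Q by rewrite (leq_trans q1)// -{1}(expn1 q) leq_exp2l.
apply: leq_trans Qn; clearbody Q.
apply: (@leq_trans (Q * (Q ^ 6 * Q))).
  apply: leq_mul; first exact: leq_trans tQ.
  by apply: leq_mul tQ; rewrite -[64]/(2 ^ 6) leq_exp2r.
by rewrite -expnSr -expnS leq_pexp2l//; lia.
Qed.

(** In order: no long run, a repeated window, a run at a cut, a standard factor starting near an
    end. This sum bounds every error below. *)
Definition error n k := let t := scale n in
  no_run_bound n (12 * t).+1 + n.+1 ^ 2 * q ^ (n - 64 * t) +
  4 * (64 * t) * q ^ (n - ((12 * t).+1 + 6 * t)) +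
  (4 * (64 * t) + k) * q ^ (n - ((12 * t).+1 + 12 * t)).

(** The error is smaller than the number of Lyndon words, about [q^n / n], by a factor of order
    [q^t], which tends to infinity. *)
Lemma error_small : exists C, forall n k, 0 < scale n -> k <= scale n ->
  n * error n k * q ^ scale n <= C * q ^ n.
Proof.
exists (78 ^ 6 * q ^ 22 + q ^ 48 + 256 * q ^ 16 + 257 * q ^ 16) => n k.
have [->|n0] := posnP n; first by rewrite !mul0n.
move=> t0 kt; have := no_run_bound_small erefl t0.
have [_ nQ] := scale_bounds n0; have tQ := scale_leq n.
have room : 64 * scale n <= n by rewrite -[X in X <= _]mul1n scale_room.
rewrite /error; set t := scale n in t0 kt nQ tQ room *.
set Q := q ^ t in nQ tQ *.
move: (78 ^ 6) (no_run_bound _ _) => K Z Zle.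
have Q0 : 0 < Q by rewrite expn_gt0; lia.
have split_pow e : e <= n -> q ^ n = q ^ e * q ^ (n - e).
  by move=> en; rewrite -expnD subnKC.
have pow e : q ^ (e * t) = Q ^ e by rewrite mulnC expnM.
clearbody Q.
have t2 : n * (n.+1 ^ 2 * q ^ (n - 64 * t)) * Q <= q ^ 48 * q ^ n.
  rewrite (split_pow (64 * t))// pow.
  rewrite (_ : n * _ * Q = n * n.+1 ^ 2 * Q * q ^ (n - 64 * t)); last by ring.
  rewrite mulnA leq_mul2r; apply/orP; right.
  apply: (@leq_trans ((q ^ 16 * Q ^ 16) ^ 3 * Q)).
    rewrite leq_mul2r [X in _ <= X]expnS; apply/orP; right.
    by apply: leq_mul; [exact: ltnW|rewrite leq_exp2r].
  rewrite expnMn -!expnM -mulnA leq_mul2l -expnSr; apply/orP; right.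
  by rewrite leq_pexp2l.
(* As [t <= Q], the number of positions is at most [c Q]; since [n] is at most [q^16 Q^16], the
   product [n Q^2] needs exactly the exponent 18. *)
have linear c e : e = 18 \/ e = 24 -> 
    n * (c * Q * q ^ (n - (e * t).+1)) * Q <= c * q ^ 16 * q ^ n.
  move=> eE; have le18 : 18 <= e by case: eE => ->.
  rewrite (split_pow (e * t).+1); last by case: eE => ->; clear -room t0; lia.
  rewrite (expnS q (e * t)) pow.
  rewrite (_ : n * _ * Q = n * Q ^ 2 * (c * q ^ (n - (e * t).+1))); last by ring.
  rewrite (_ : c * _ * _ = q ^ 16 * (q * Q ^ e) * (c * q ^ (n - (e * t).+1))); last by ring.
  rewrite leq_mul2r; apply/orP; right.
  apply: (@leq_trans ((q ^ 16 * Q ^ 16) * Q ^ 2)).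
    by rewrite leq_mul2r (ltnW nQ) orbT.
  rewrite -mulnA leq_mul2l -expnD; apply/orP; right.
  apply: (@leq_trans (Q ^ e)); first by rewrite leq_pexp2l.
  by rewrite leq_pmull//; lia.
have t3 : n * (4 * (64 * t) * q ^ (n - ((12 * t).+1 + 6 * t))) * Q <=
    256 * q ^ 16 * q ^ n.
  apply: leq_trans (linear 256 18 _); last by left.
  rewrite (_ : (12 * t).+1 + 6 * t = (18 * t).+1); last by clear; lia.
  by rewrite leq_mul2r leq_mul2l leq_mul2r mulnA leq_mul2l tQ !orbT.
have t4 : n * ((4 * (64 * t) + k) * q ^ (n - ((12 * t).+1 + 12 * t))) * Q <=
    257 * q ^ 16 * q ^ n.
  apply: leq_trans (linear 257 24 _); last by right.
  rewrite (_ : (12 * t).+1 + 12 * t = (24 * t).+1); last by clear; lia.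
  rewrite leq_mul2r leq_mul2l leq_mul2r.
  have -> : 4 * (64 * t) + k <= 257 * Q by clear -kt tQ; lia.
  by rewrite !orbT.
move: {linear} t2 t3 t4 Zle.
move: (_ ^ 2 * _) (4 * _ * _) ((_ + k) * _) (K * _) (q ^ 48) (256 * _) (257 * _).
move=> z2 z3 z4 c1 c2 c3 c4 t2 t3 t4 t1.
rewrite (_ : n * _ * Q = n * Z * Q + n * z2 * Q + n * z3 * Q + n * z4 * Q); last by ring.
rewrite (_ : _ * q ^ n = c1 * q ^ n + c2 * q ^ n + c3 * q ^ n + c4 * q ^ n); last by ring.
by rewrite !leq_add.
Qed.

End Scales.

(** * Position statistics for a fixed length *)

Section FiniteSums.
Context {d : Order.disp_t} {A : finOrderType d} (a : A).
Hypothesis a_min : forall x, (a <= x)%O.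
Local Notation q := #|A|.
Hypothesis q1 : 1 < q.
Implicit Types (w : seq A) (b c j k n : nat).
Local Notation t := (scale q).
Local Notation m n := (64 * t n).
Local Notation len n k := ((n - 4 * m n) %/ k).
Local Notation L n := (nwords n (@lyndon _ A)).
Local Notation err := (error q).

Definition nlyndon_block n k b :=
  nwords n (fun w => lyndon w && block (m n) (len n k) b (std_pos w)).
Definition nlyndon_one n := nwords n (fun w => lyndon w && (std_pos w == 1)).
(** The additional [k] on the right absorbs the remainder of [n - 4 m] modulo [k]. *)
Definition at_ends n k j :=
  (1 < j) && ((j < (m n).*2) || (n - ((m n).*2 + k) <= j)).

Lemma room n k : 0 < k -> k + 4 <= t n ->
  [/\ 0 < t n, m n <= len n k, k * len n k + 4 * m n <= n & 4 * m n <= n].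
Proof.
move=> k0 kt; have t0 : 0 < t n by lia.
have r1 : (k + 4) * m n <= n by exact: scale_room.
split=> //; first by rewrite leq_divRL//; lia.
  by have := leq_divM (n - 4 * m n) k; rewrite mulnC; lia.
by apply: leq_trans r1; rewrite leq_mul2r; apply/orP; right; lia.
Qed.

Lemma nlyndon_block_flat n k b c : k + 4 <= t n -> b < k -> c < k ->
  nlyndon_block n k b <= nlyndon_block n k c + err n k.
Proof.
move=> kt bk ck; have [t0 ml kl rm] := room (leq_ltn_trans (leq0n b) bk) kt.
apply: (nwords_block (a := a) a_min (h := 12 * t n) (g := 6 * t n) _ _ _ bk ck) => //;
  try (by clear -t0; lia).
move=> u un; apply: leq_trans (nwords_bad a _ _ _ _) _ => //;
  try (by clear -t0; lia).
rewrite /error /no_run_bound; set z := nwords _ _.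
have zZ : z <= _ := nwords_no_run a n (ltn0Sn (12 * t n)).
by apply: leq_trans (leq_addr _ _); rewrite !leq_add2r.
Qed.

Lemma nlyndon_ends n k : 0 < k -> k + 4 <= t n ->
  nwords n (fun w => lyndon w && at_ends n k (std_pos w)) <= err n k.
Proof.
move=> k0 kt; have [t0 ml kl rm] := room k0 kt.
apply: leq_trans (nwords_ends a_min (h := 12 * t n) _ _ _ _) _;
  try (by clear -t0 rm; lia).
rewrite /error /no_run_bound; set z := nwords _ _.
have zZ : z <= _ := nwords_no_run a n (ltn0Sn (12 * t n)).
rewrite (_ : (m n).*2 + ((m n).*2 + k) = 4 * m n + k); last by clear; lia.
by rewrite leq_add2r -addnA (leq_trans zZ) ?leq_addr.
Qed.

Lemma nlyndon_one_bounds n k : 0 < k -> k + 4 <= t n.+1 ->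
  L n <= nlyndon_one n.+1 <= L n + err n.+1 k.
Proof.
move=> k0 kt; have [t0 ml kl rm] := room k0 kt.
rewrite (nwords_one_ge a_min) /=; last by clear -t0 rm; lia.
apply: leq_trans (nwords_one_le a_min (12 * t n.+1) _) _; first by clear -t0 rm; lia.
rewrite /error /no_run_bound; set z := nwords _ _.
have zZ : z <= _ := nwords_no_run a n.+1 (ltn0Sn (12 * t n.+1)).
rewrite addnC leq_add2l; apply: (leq_trans zZ).
by do 2 apply: (leq_trans _ (leq_addr _ _)); exact: leq_addr.
Qed.

Lemma nlyndon_bounds n k : 0 < k -> k + 4 <= t n ->
  n * L n <= q ^ n <= n * L n + err n k.
Proof.
move=> k0 kt; have [t0 ml kl rm] := room k0 kt.
rewrite nwords_lyndon_le /=.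
apply: leq_trans (@nwords_lyndon_ge _ A n (m n) _ _) _; try (by clear -t0 rm; lia).
rewrite leq_add2l; apply: leq_trans (nwords_dup_win _ _) _.
rewrite /error; apply: (leq_trans _ (leq_addr _ _)).
by apply: (leq_trans _ (leq_addr _ _)); exact: leq_addl.
Qed.

(** Written as a quotient, the index of the block containing [j] is visibly unique. *)
Lemma blockP mm l b j : 0 < l ->
  block mm l b j = (mm.*2 <= j) && ((j - mm.*2) %/ l == b).
Proof.
move=> l0; rewrite /block; have [mj|mj] := leqP mm.*2 j; last first.
  by apply/negbTE; rewrite negb_and -ltnNge; apply/orP; left; lia.
have -> : (mm.*2 + b * l <= j) = (b <= (j - mm.*2) %/ l).
  by rewrite leq_divRL//; lia.
have -> : (j < mm.*2 + b.+1 * l) = ((j - mm.*2) %/ l <= b).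
  by rewrite -[in RHS]ltnS ltn_divLR//; lia.
by rewrite /= eqn_leq andbC.
Qed.

Local Open Scope ring_scope.
Variable R : realFieldType.

Lemma nwords_sum n (P : pred (seq A)) :
  (nwords n P)%:R = \sum_(w <- words n) (P w)%:R :> R.
Proof.
rewrite /nwords -sum1_count natr_sum [RHS](bigID P) /= [X in _ = _ + X]big1 ?addr0.
  by apply: eq_bigr => w ->.
by move=> w /negbTE ->.
Qed.

(** A position is 1, or in exactly one block, or at an end. The values [xi b] with [b < k] stand for
    the blocks and [xi k] for position 1; the ends are few and cost at most [M] each. *)
Lemma lyndon_sum_approx n k (f xi : nat -> R) (e M : R) : (0 < k)%N ->
  (k + 4 <= t n)%N -> 0 <= e -> 0 <= M ->
  `|f 1 - xi k| <= e ->
  (forall b j, (b < k)%N -> (j < n)%N -> block (m n) (len n k) b j ->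
     `|f j - xi b| <= e) ->
  (forall j, (0 < j < n)%N -> `|f j| <= M) ->
  `|\sum_(w <- words n | @lyndon _ A w) f (std_pos w) -
    ((nlyndon_one n)%:R * xi k + \sum_(b < k) (nlyndon_block n k b)%:R * xi b)|
  <= (L n)%:R * e + M * (err n k)%:R.
Proof.
move=> k0 kt e0 M0 f1 fb fM; have [t0 ml kl rm] := room k0 kt.
have l0 : (0 < len n k)%N by clear -t0 ml; lia.
have m2 : (1 < (m n).*2)%N by clear -t0; lia.
have := nlyndon_ends k0 kt; set E := nwords _ _ => Ele.
apply: (@le_trans _ _ ((L n)%:R * e + M * E%:R)); last first.
  by rewrite lerD2l ler_wpM2l// ler_nat.
have -> : \sum_(b < k) (nlyndon_block n k b)%:R * xi b = \sum_(w <- @words _ A n)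
    \sum_(b < k) (lyndon w && block (m n) (len n k) b (std_pos w))%:R * xi b.
  rewrite exchange_big /=; apply: eq_bigr => b _.
  by rewrite /nlyndon_block nwords_sum mulr_suml.
rewrite {Ele}/E /nlyndon_one !nwords_sum !mulr_suml mulr_sumr -!big_split /= big_mkcond /= -sumrB.
apply: le_trans (ler_norm_sum _ _ _) _.
rewrite !big_seq; apply: ler_sum => w; rewrite mem_words => /eqP wn.
case: ifPn => lw; last first.
  by rewrite !mul0r mulr0 big1 ?addr0 ?subr0 ?normr0// => i _; rewrite mul0r.
have [|jn _ _] := @std_posP _ _ w; first by rewrite wn; clear -t0 rm; lia.
move: (std_pos w) jn; rewrite wn => j jn; rewrite mul1r /=.
under eq_bigr do rewrite blockP//.
have [->|j1] := eqVneq j 1%N.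
  rewrite mul1r big1 ?addr0 ?(le_trans f1) ?lerDl ?mulr_ge0//.
  by move=> b _; rewrite leqNgt m2 mul0r.
rewrite mul0r add0r.
have [|nblock] := boolP [exists b : 'I_k, block (m n) (len n k) b j].
  move=> /existsP[b bj]; have := bj; rewrite blockP// => /andP[mj /eqP bE].
  rewrite (bigD1 b)//= mj bE eqxx mul1r big1 ?addr0.
    have le := fb b j (ltn_ord b) _ bj.
    by rewrite (le_trans (le _)) ?lerDl ?mulr_ge0//; case/andP: jn.
  by move=> c cb; rewrite (inj_eq val_inj) eq_sym (negbTE cb) mul0r.
rewrite big1 ?subr0; last first.
  move=> b _; rewrite -blockP//; move/existsPn: nblock => /(_ b)/negbTE ->.
  by rewrite mul0r.
(* If [j] were not at an end, its quotient by the block length would be an index below [k]. *)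
have -> : at_ends n k j.
  rewrite /at_ends; apply/andP; split; first by clear -jn j1; lia.
  have [//|mj /=] := ltnP j (m n).*2.
  rewrite leqNgt; apply: contra nblock => jk.
  have bk : ((j - (m n).*2) %/ len n k < k)%N.
    rewrite ltn_divLR//; have := divn_eq (n - 4 * m n) k.
    have := ltn_pmod (n - 4 * m n) k0; rewrite [(_ * k)%N]mulnC => h1 h2.
    move: (_ %% _)%N (_ %/ k)%N h1 h2 => r l h1 h2.
    by move: (k * l)%N (64 * _)%N rm mj jk h2 => x z rm mj jk h2; clear -h1 h2 jk mj rm; lia.
  by apply/existsP; exists (Ordinal bk); rewrite blockP// mj eqxx.
by rewrite mulr1 (le_trans (fM j jn))// lerDr.
Qed.

End FiniteSums.

Local Open Scope classical_set_scope.
Local Open Scope ring_scope.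

(** * Limits *)

Section RiemannSums.
Variables (R : realType) (f : R -> R).
Hypothesis f_cont : continuous f.
Local Notation mu := (@lebesgue_measure R).

Lemma unit_itv_bounded : exists2 M : R, 0 <= M &
  forall x : R, 0 <= x <= 1 -> `|f x| <= M.
Proof.
have cK : compact (f @` `[0, 1]).
  by apply: continuous_compact; [exact: continuous_subspaceT|exact: segment_compact].
have [M [Mreal bM]] := compact_bounded cK.
exists (`|M| + 1) => [|x x01]; first by rewrite addr_ge0.
apply: (bM (`|M| + 1)); first by rewrite ltr_pwDr// ler_norm.
by exists x => //=; rewrite in_itv.
Qed.

Lemma unit_itv_unif_continuous (e : R) : 0 < e -> exists2 del : R, 0 < del &
  forall x y : R, 0 <= x <= 1 -> `|x - y| <= del -> `|f x - f y| <= e.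
Proof.
move=> e0; have /compact_near_coveringP cov := @segment_compact R 0 1.
pose P (del x : R) := forall y, `|x - y| <= del -> `|f x - f y| <= e.
have H : \forall del \near 0^'+, `[0, 1] `<=` P del.
  apply: cov => x _.
  have /cvgrPdist_le /(_ (e / 2)) := @f_cont x.
  rewrite divr_gt0// => /(_ isT) /nbhs_ballP[r /= r0 fr].
  near=> x' del => y x'y.
  have xx' : `|x - x'| < r / 2.
    by near: x'; apply: (@nbhsx_ballx _ _ x (r / 2)); rewrite divr_gt0.
  have delr : del <= r / 2.
    by near: del; apply: nbhs_right_le; rewrite divr_gt0.
  have fx' : `|f x - f x'| <= e / 2.
    by apply: fr; rewrite /ball/=; apply: lt_trans xx' _; rewrite ltr_pdivrMr//; lra.
  have fy : `|f x - f y| <= e / 2.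
    apply: fr; rewrite /ball/=; apply: le_lt_trans (ler_distD x' x y) _.
    by rewrite (splitr r); apply: ltr_leD => //; exact: le_trans x'y delr.
  apply: le_trans (ler_distD (f x) (f x') (f y)) _.
  by rewrite (splitr e) lerD// distrC.
near (0 : R)^'+ => del; exists del => [//|x y x01].
have Pdel : `[0, 1] `<=` P del by near: del.
by apply: Pdel => //=; rewrite in_itv.
Unshelve. all: by end_near. Qed.

Lemma integrable_segment a b : mu.-integrable `[a, b] (EFin \o f).
Proof.
apply: continuous_compact_integrable; first exact: segment_compact.
exact: continuous_subspaceT.
Qed.

(* The base point [-1] makes [[0, 1]] interior to the domain of the primitive. *)
Lemma mean_value_integral (a b : R) : -1 < a -> a < b -> b < 2 ->
  exists2 c, a <= c <= b &
  (\int[mu]_(x in `[-1, b]) f x - \int[mu]_(x in `[-1, a]) f x = f c * (b - a))%R.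
Proof.
move=> a1 ab b2; pose F (x : R) := (\int[mu]_(t in `[-1, x]) f t)%R.
have dF (x : R) : -1 < x -> x < 2 -> is_derive x 1 F (f x).
  move=> x1 x2.
  have [dFx <-] := continuous_FTC1_closed x2 (integrable_segment (-1) 2) x1 (@f_cont x).
  by rewrite derive1E; exact: derivableP.
have [||c cab E] := @MVT_segment R F f a b (ltW ab).
- by move=> x /[!in_itv]/= /andP[ax xb]; apply: dF; lra.
- apply: derivable_within_continuous => x /[!in_itv]/= /andP[ax xb].
  have x1 : -1 < x by lra.
  have x2 : x < 2 by lra.
  by have [] := dF x x1 x2.
by exists c => //; move: cab; rewrite in_itv.
Qed.

(** The nodes descend from 1 because a suffix at position [j] has relative length [1 - j / n]. On
    each cell the mean value theorem replaces the integral by a value of [f], within [e] of that at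
    the right end. *)
Lemma riemann_sum_error (k : nat) (e : R) : (0 < k)%N ->
  (forall x y : R, 0 <= x <= 1 -> `|x - y| <= k%:R^-1 -> `|f x - f y| <= e) ->
  `|(\int[mu]_(x in `[0%R, 1%R[) f x)%R
    - k%:R^-1 * \sum_(b < k) f (1 - b%:R / k%:R)| <= e.
Proof.
move=> k0 osc; have kR : 0 < k%:R :> R by rewrite ltr0n.
pose F (x : R) := (\int[mu]_(t in `[-1, x]) f t)%R.
pose p b : R := 1 - b%:R / k%:R.
have FE : (\int[mu]_(x in `[0%R, 1%R[) f x)%R = F 1 - F 0.
  rewrite /F Rintegral_itvB ?bnd_simp//; try lra; last exact: integrable_segment.
  have int01 : mu.-integrable `[0, 1] (EFin \o f) by exact: integrable_segment.
  rewrite Rintegral_itv_obnd_cbnd; last first.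
    by apply: integrableS int01 => //; exact: subset_itv_oc_cc.
  rewrite Rintegral_itv_bndo_bndc//.
  by apply: integrableS int01 => //; exact: subset_itv_co_cc.
have telF : F 1 - F 0 = \sum_(b < k) (F (p b) - F (p b.+1)).
  rewrite -(big_mkord xpredT (fun b => F (p b) - F (p b.+1))).
  under eq_bigr do rewrite -opprB.
  rewrite sumrN telescope_sumr// /p mul0r subr0 divff ?subrr ?opprB//.
  by rewrite gt_eqF.
rewrite FE telF mulr_sumr -sumrB; apply: le_trans (ler_norm_sum _ _ _) _.
apply: (@le_trans _ _ (\sum_(b < k) (k%:R^-1 * e))); last first.
  by rewrite sumr_const card_ord -[leLHS]mulr_natl mulrA divff ?mul1r// gt_eqF.
apply: ler_sum => b _.
have pE : p b - p b.+1 = k%:R^-1.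
  by rewrite /p opprB addrC addrA subrK -mulrBl -natr1 addrAC subrr add0r mul1r.
have kV : 0 < k%:R^-1 :> R by rewrite invr_gt0.
have pb1 : 0 <= p b.+1.
  by rewrite subr_ge0 ler_pdivrMr// mul1r ler_nat ltn_ord.
have pb : p b <= 1 by rewrite gerBl divr_ge0// ltW.
rewrite -/(p b); move: (p b) (p b.+1) pE pb1 pb => u v uv v0 u1.
have [|||c /andP[c1 c2] ->] := @mean_value_integral v u; try lra.
rewrite uv mulrC -mulrBr normrM gtr0_norm// ler_wpM2l ?(ltW kV)//.
rewrite distrC; apply: osc; first by apply/andP; split; lra.
by rewrite ler_norml; apply/andP; split; lra.
Qed.

End RiemannSums.

(** * Limiting frequencies of position 1 and of the blocks *)

Section Limits.
Context {d : Order.disp_t} {A : finOrderType d} (a : A).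
Hypothesis a_min : forall x, (a <= x)%O.
Local Notation q := #|A|.
Hypothesis q1 : (1 < q)%N.
Variable R : realType.
Local Notation L n := ((nwords n (@lyndon _ A))%:R : R).
Local Notation err n k := ((error q n k)%:R : R).
Local Notation qR := (q%:R : R).

Let q0 : 0 < qR. Proof. by rewrite ltr0n ltnW. Qed.

Lemma near_scale k : \forall n \near \oo, (k <= scale q n)%N.
Proof. by exists ((q ^ 16) ^ k)%N => // n /= kn; exact: leq_scale. Qed.

(** The spare factor [q^t] of [error_small] eventually exceeds any [K], here chosen above
    [C / e]. *)
Lemma error_cvg k : (n%:R * err n k / qR ^+ n) @[n --> \oo] --> 0.
Proof.
have [C HC] := error_small q1; apply/cvgrPdist_le => /= e e0.
near=> n; rewrite sub0r normrN ger0_norm ?divr_ge0 ?mulr_ge0 ?exprn_ge0//.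
pose K := (Num.trunc (C%:R / e)).+1.
have Kt : (K <= scale q n)%N by near: n; exact: near_scale.
have kt : (k <= scale q n)%N by near: n; exact: near_scale.
have t0 : (0 < scale q n)%N by rewrite (leq_trans _ Kt).
have : (n * error q n k * K <= C * q ^ n)%N.
  apply: leq_trans (HC n k t0 kt); rewrite leq_mul2l; apply/orP; right.
  by rewrite (leq_trans Kt)// scale_leq.
rewrite -(ler_nat R) !natrM natrX => le.
have CK : C%:R <= e * K%:R by rewrite mulrC -ler_pdivrMr// ltW// truncnS_gt.
rewrite ler_pdivrMr ?exprn_gt0// -(@ler_pM2r _ K%:R) ?ltr0n//.
apply: le_trans le _; rewrite mulrAC ler_pM2r ?exprn_gt0//.
Unshelve. all: by end_near. Qed.

Lemma nlyndon_cvg : (n%:R * L n / qR ^+ n) @[n --> \oo] --> (1 : R).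
Proof.
apply: (@squeeze_cvgr _ _ _ _ (fun n => 1 - n%:R * err n 1 / qR ^+ n) (cst 1)).
- near=> n; have kt : (1 + 4 <= scale q n)%N by near: n; exact: near_scale.
  have n0 : (0 < n)%N by near: n; exact: nbhs_infty_gt.
  have /andP[le ge] := @nlyndon_bounds _ A q1 n 1 isT kt.
  move: le ge; rewrite -(ler_nat R) -[(_ <= _ + _)%N](ler_nat R) natrD !natrM natrX.
  move=> le ge; rewrite /cst /= ler_pdivrMr ?exprn_gt0// mul1r le andbT.
  rewrite lerBlDr -mulrDl ler_pdivlMr ?exprn_gt0// mul1r (le_trans ge)// lerD2l.
  by rewrite ler_peMl// ler1n.
- rewrite -[X in _ --> X]subr0; apply: cvgB; [exact: cvg_cst|exact: error_cvg].
- exact: cvg_cst.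
Unshelve. all: by end_near. Qed.

Lemma near_nlyndon_gt0 : \forall n \near \oo, 0 < L n.
Proof.
near=> n; have : 0 < n%:R * L n / qR ^+ n.
  by near: n; apply: (cvgr_gt _ nlyndon_cvg); exact: ltr01.
rewrite [in X in _ -> X]lt0r ler0n andbT; apply: contraTneq => ->.
by rewrite mulr0 mul0r ltxx.
Unshelve. all: by end_near. Qed.

Lemma error_ratio_cvg k : (err n k / L n) @[n --> \oo] --> (0 : R).
Proof.
have h : ((n%:R * err n k / qR ^+ n) * (n%:R * L n / qR ^+ n)^-1) @[n --> \oo] -->
    0 * (1 : R)^-1.
  apply: cvgM; first exact: error_cvg.
  by apply: cvgV; [exact: oner_neq0|exact: nlyndon_cvg].
rewrite mul0r in h; apply: (cvg_trans _ h); apply: near_eq_cvg; near=> n.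
have L0 : 0 < L n by near: n; exact: near_nlyndon_gt0.
have n0 : (n%:R : R) != 0.
  by rewrite pnatr_eq0 -lt0n; near: n; exact: nbhs_infty_gt.
have qn0 : qR ^+ n != 0 by rewrite expf_neq0// gt_eqF.
by rewrite /=; field; rewrite n0 qn0 gt_eqF.
Unshelve. all: by end_near. Qed.

Lemma nlyndon_ratio_cvg : (L n / L n.+1) @[n --> \oo] --> qR^-1.
Proof.
have c1 : (n%:R / n.+1%:R) @[n --> \oo] --> (1 : R).
  have -> : (fun n => n%:R / n.+1%:R) = (fun n => 1 - n.+1%:R^-1) :> (nat -> R).
    apply/funext => n; rewrite -[in n%:R / _](addrK 1 n%:R) natr1.
    by rewrite mulrBl mul1r divff// pnatr_eq0.
  rewrite -[X in _ --> X]subr0; apply: cvgB; [exact: cvg_cst|exact: cvg_harmonic].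
have c2 := nlyndon_cvg; move: (c2); rewrite -cvg_shiftS => c3.
have h : (n%:R * L n / qR ^+ n * (n.+1%:R * L n.+1 / qR ^+ n.+1)^-1 *
    (n%:R / n.+1%:R)^-1 * qR^-1) @[n --> \oo] --> 1 * (1 : R)^-1 * 1^-1 * qR^-1.
  apply: cvgM; last exact: cvg_cst.
  by apply: cvgM; [apply: cvgM => //|]; apply: cvgV => //; exact: oner_neq0.
rewrite invr1 !mul1r in h; apply: (cvg_trans _ h); apply: near_eq_cvg; near=> n.
have L0 : 0 < L n.+1.
  near: n; have [N _ H] := near_nlyndon_gt0.
  by exists N => // m /= Nm; apply: H => /=; exact: leqW.
have n0 : (n%:R : R) != 0.
  by rewrite pnatr_eq0 -lt0n; near: n; exact: nbhs_infty_gt.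
have qn0 : qR ^+ n != 0 by rewrite expf_neq0// gt_eqF.
rewrite /= exprS; field.
by rewrite n0 qn0 gt_eqF// gt_eqF//= addrC natr1 pnatr_eq0.
Unshelve. all: by end_near. Qed.

(** Deleting the first letter compares this count with the Lyndon words of length one less, of which
    there are about [q] times fewer. *)
Lemma nlyndon_one_cvg : ((nlyndon_one (A := A) n)%:R / L n) @[n --> \oo] --> qR^-1.
Proof.
rewrite -cvg_shiftS /=.
have cerr : (err n.+1 1 / L n.+1) @[n --> \oo] --> (0 : R).
  by have := error_ratio_cvg 1; rewrite -cvg_shiftS.
apply: (@squeeze_cvgr _ _ _ _ (fun n => L n / L n.+1)
  (fun n => L n / L n.+1 + err n.+1 1 / L n.+1)).
- near=> n.
  have kt : (1 + 4 <= scale q n.+1)%N.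
    near: n; have [N _ H] := near_scale (1 + 4).
    by exists N => // m /= Nm; apply: H => /=; exact: leqW.
  have /andP[le ge] := nlyndon_one_bounds a_min q1 (isT : 0 < 1)%N kt.
  rewrite -mulrDl !ler_wpM2r ?invr_ge0// -?natrD ler_nat//.
- exact: nlyndon_ratio_cvg.
- rewrite -[X in _ --> X]addr0; apply: cvgD => //; exact: nlyndon_ratio_cvg.
Unshelve. all: by end_near. Qed.

(** The [k] blocks share the mass [1 - 1 / q] left by position 1, and have equal counts up to the
    error. *)
Lemma nlyndon_block_cvg k b : (b < k)%N ->
  ((nlyndon_block (A := A) n k b)%:R / L n) @[n --> \oo] -->
  (1 - qR^-1) / k%:R.
Proof.
move=> bk; have k0 := leq_ltn_trans (leq0n b) bk.
have kR : 0 < k%:R :> R by rewrite ltr0n.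
have c : ((1 - (nlyndon_one (A := A) n)%:R / L n) / k%:R) @[n --> \oo] -->
    (1 - qR^-1) / k%:R.
  by apply: cvgM; [apply: cvgB; [exact: cvg_cst|exact: nlyndon_one_cvg]|exact: cvg_cst].
apply/cvgrPdist_le => /= e e0; near=> n.
have kt : (k + 4 <= scale q n)%N by near: n; exact: near_scale.
have L0 : 0 < L n by near: n; exact: near_nlyndon_gt0.
have ce : `|0 - err n k / L n| <= e / 4.
  by near: n; move/cvgrPdist_le : (error_ratio_cvg k); apply; rewrite divr_gt0.
have cc : `|(1 - qR^-1) / k%:R - (1 - (nlyndon_one (A := A) n)%:R / L n) / k%:R| <= e / 2.
  by near: n; move/cvgrPdist_le : c; apply; rewrite divr_gt0.
set W := (nlyndon_block n k b)%:R; set W1 := (nlyndon_one n)%:R in cc *.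
set E := err n k in ce.
(* The constant function 1 turns the approximation of sums into the partition of
   the Lyndon words according to the position. *)
have tot : `|L n - (W1 + \sum_(c < k) (nlyndon_block (A := A) n k c)%:R)| <= E.
  have := @lyndon_sum_approx _ A a a_min q1 R n k (fun=> 1) (fun=> 1) 0 1 k0 kt
    (lexx _) ler01.
  rewrite subrr normr0 lexx normr1 => /(_ isT).
  move=> /(_ (fun _ _ _ _ _ => isT) (fun _ _ => lexx _)).
  rewrite mulr0 add0r mul1r mulr1 -mulr_suml mulr1.
  rewrite (_ : \sum_(w <- words n | lyndon w) 1 = L n)//.
  by rewrite /nwords -sum1_count natr_sum.
have dev : `|k%:R * W - \sum_(c < k) (nlyndon_block (A := A) n k c)%:R| <= k%:R * E.
  have -> : k%:R * W = \sum_(c < k) W.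
    by rewrite sumr_const card_ord -[RHS]mulr_natl.
  have -> : k%:R * E = \sum_(c < k) E.
    by rewrite sumr_const card_ord -[RHS]mulr_natl.
  rewrite -sumrB; apply: le_trans (ler_norm_sum _ _ _) _; apply: ler_sum => i _.
  rewrite ler_distlC /W /E lerBlDr -!natrD !ler_nat.
  by rewrite !(nlyndon_block_flat a_min q1 kt).
have E0 : 0 <= E by [].
have k1 : 1 <= k%:R :> R by rewrite ler1n.
(* The partition costs [E] and the comparison of blocks [k E], at most [2 k E] together, to be
   divided by [k L]. *)
have WE : `|(1 - W1 / L n) / k%:R - W / L n| <= 2 * (E / L n).
  have -> : (1 - W1 / L n) / k%:R - W / L n =
      (L n - W1 - k%:R * W) / (k%:R * L n).
    by field; rewrite !gt_eqF.
  rewrite normrM normfV (gtr0_norm (mulr_gt0 kR L0)) ler_pdivrMr ?mulr_gt0//.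
  have -> : 2 * (E / L n) * (k%:R * L n) = 2 * k%:R * E by field; rewrite gt_eqF.
  move: tot dev; set S := \sum_(c < k) _ => tot dev.
  have EkE : E <= k%:R * E by rewrite ler_peMl.
  have -> : L n - W1 - k%:R * W = (L n - (W1 + S)) - (k%:R * W - S) by ring.
  by apply: le_trans (ler_normB _ _) _; rewrite -mulrA mulr2n mulrDl !mul1r lerD// (le_trans tot).
rewrite sub0r normrN ger0_norm ?divr_ge0// ?(ltW L0)// in ce.
apply: le_trans (ler_distD ((1 - W1 / L n) / k%:R) _ _) _.
rewrite (splitr e) lerD//; apply: le_trans WE _.
by rewrite mulrC -ler_pdivlMr//; apply: le_trans ce _; lra.
Unshelve. all: by end_near. Qed.

End Limits.

(** This is [|j / n - b / k| <= 2 / k] without denominators; since [4 k m <= n], the slack covers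
    the block width, the margins and the remainder. *)
Lemma block_close q n k b j : (1 < q)%N -> (0 < k)%N -> (4 * k + 4 <= scale q n)%N ->
  (b < k)%N -> block (64 * scale q n) ((n - 4 * (64 * scale q n)) %/ k) b j ->
  (j * k <= b * n + 2 * n)%N /\ (b * n <= j * k + 2 * n)%N.
Proof.
move=> q1 k0 kt bk; rewrite /block.
have t0 : (0 < scale q n)%N by lia.
have room : (4 * k * (64 * scale q n) <= n)%N by apply: scale_room => //; lia.
have room4 : (4 * (64 * scale q n) <= n)%N by apply: scale_room => //; lia.
have km : (k <= 64 * scale q n)%N by lia.
have dE := divn_eq (n - 4 * (64 * scale q n)) k.
have := ltn_pmod (n - 4 * (64 * scale q n)) k0.
move: (_ %% k)%N (_ %/ k)%N dE => r l; move: (64 * _)%N room room4 km => z room room4 km.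
move=> dE rk /andP[jl ju].
have {}dE : (n = l * k + r + 4 * z)%N by clear -dE room4; lia.
have ju' : (j * k <= (z.*2 + b.+1 * l) * k)%N by rewrite leq_mul2r ltnW// orbT.
have jl' : ((z.*2 + b * l) * k <= j * k)%N by rewrite leq_mul2r jl orbT.
have b1 : (b * (r + 4 * z) <= k * (k + 4 * z))%N by apply: leq_mul; lia.
have b2 : (k * k <= k * z)%N by rewrite leq_mul2l km orbT.
clear -dE ju' jl' b1 b2 room; nia.
Qed.

(** * Convergence of the mean of a continuous function *)

Section MeanLimit.
Context {d : Order.disp_t} {A : finOrderType d} (a : A).
Hypothesis a_min : forall x, (a <= x)%O.
Local Notation q := #|A|.
Hypothesis q1 : (1 < q)%N.
Variables (R : realType) (F : R -> R).
Hypothesis F_cont : continuous F.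
Local Notation mu := (@lebesgue_measure R).
Local Notation L n := ((nwords n (@lyndon _ A))%:R : R).
Local Notation qR := (q%:R : R).

(** With [k] blocks fixed first, [e] is shared equally by the Riemann sum, the convergence of
    frequencies, the oscillation of [F] on blocks, and the positions near the ends. *)
Lemma lyndon_mean_cvg :
  ((\sum_(w <- words n | @lyndon _ A w) F ((n - std_pos w)%N%:R / n%:R)) / L n)
    @[n --> \oo] -->
  qR^-1 * F 1 + (1 - qR^-1) * (\int[mu]_(x in `[0%R, 1%R[) F x)%R.
Proof.
apply/cvgrPdist_le => /= e e0.
have [M M0 FM] := unit_itv_bounded F_cont.
have e4 : 0 < e / 4 by rewrite divr_gt0.
have [del del0 osc] := unit_itv_unif_continuous F_cont e4.
(* Ensures [2 / k <= del], where [2 / k] is the precision of [block_close]. *)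
pose k := (Num.trunc (2 / del)).+1.
have kR : 0 < k%:R :> R by rewrite ltr0n.
have kdel : 2 / k%:R <= del.
  by rewrite ler_pdivrMr// mulrC -ler_pdivrMr// ltW// truncnS_gt.
have kdel1 : k%:R^-1 <= del.
  by apply: le_trans kdel; rewrite -[leLHS]mul1r ler_pM2r ?invr_gt0// ler1n.
have qV0 : 0 <= 1 - qR^-1.
  by rewrite subr_ge0 invf_le1 ?ler1n ?ltr0n ltnW// ltnW.
have qV1 : 1 - qR^-1 <= 1 by rewrite gerBl invr_ge0.
set I := (\int[mu]_(x in _) F x)%R.
(* The index [k] encodes the atom: position 1 has limiting ratio 1. *)
pose xi b : R := F (if b == k then 1 else 1 - b%:R / k%:R).
pose avg n := (nlyndon_one (A := A) n)%:R / L n * F 1 +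
  \sum_(b < k) (nlyndon_block (A := A) n k b)%:R / L n * xi b.
pose lim := qR^-1 * F 1 + \sum_(b < k) (1 - qR^-1) / k%:R * xi b.
have avg_cvg : avg n @[n --> \oo] --> lim.
  apply: cvgD.
    by apply: cvgM; [exact: nlyndon_one_cvg a_min q1 R|exact: cvg_cst].
  apply: cvg_big => [|b _]; first exact: add_continuous.
  apply: cvgM; last exact: cvg_cst.
  exact: nlyndon_block_cvg a_min q1 R _ _ (ltn_ord b).
have limI : `|qR^-1 * F 1 + (1 - qR^-1) * I - lim| <= e / 4.
  rewrite /lim opprD addrACA subrr add0r.
  have -> : \sum_(b < k) (1 - qR^-1) / k%:R * xi b =
      (1 - qR^-1) * (k%:R^-1 * \sum_(b < k) F (1 - b%:R / k%:R)).
    rewrite mulrA mulr_sumr; apply: eq_bigr => b _.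
    by rewrite /xi ltn_eqF.
  rewrite -mulrBr normrM ger0_norm//.
  apply: (@le_trans _ _ (1 * (e / 4))); last by rewrite mul1r.
  apply: ler_pM => //.
  apply: riemann_sum_error => // x y x01 xy; apply: osc => //.
  exact: le_trans xy kdel1.
near=> n.
have kt4 : (4 * k + 4 <= scale q n)%N by near: n; exact: near_scale q1 _.
have kt : (k + 4 <= scale q n)%N by apply: leq_trans kt4; rewrite leq_add2r leq_pmull.
have L0 : 0 < L n by near: n; exact: near_nlyndon_gt0 q1 R.
have nk : (k <= n)%N by near: n; exact: nbhs_infty_ge.
have n0 : (0 < n)%N by exact: leq_trans nk.
have nR : 0 < n%:R :> R by rewrite ltr0n.
have cavg : `|lim - avg n| <= e / 4.
  by near: n; move/cvgrPdist_le : avg_cvg; apply.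
(* [M + 1] keeps the denominator positive when [M = 0]. *)
have cerr : `|0 - (error q n k)%:R / L n| <= e / 4 / (M + 1).
  near: n; move/cvgrPdist_le : (error_ratio_cvg q1 (R := R) k); apply.
  by rewrite divr_gt0// ltr_wpDl.
have posE j : (j <= n)%N -> (n - j)%N%:R / n%:R = 1 - j%:R / n%:R :> R.
  by move=> jn; rewrite natrB// mulrBl divff// gt_eqF.
have in01 j : (j <= n)%N -> (0 : R) <= 1 - j%:R / n%:R <= 1.
  move=> jn; rewrite subr_ge0 ler_pdivrMr// mul1r ler_nat jn /=.
  by rewrite gerBl divr_ge0.
have approx := @lyndon_sum_approx _ A a a_min q1 R n k
  (fun j => F ((n - j)%N%:R / n%:R)) xi (e / 4) M isT kt (ltW e4) M0.
set S := \sum_(w <- _ | _) _ in approx *.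
have {}approx : `|avg n - S / L n| <= e / 4 + e / 4.
  have -> : avg n - S / L n = - ((S - ((nlyndon_one (A := A) n)%:R * xi k +
      \sum_(b < k) (nlyndon_block (A := A) n k b)%:R * xi b)) / L n).
    rewrite /avg -[RHS]mulNr opprB mulrBl mulrDl.
    congr (_ + _ - _); first by rewrite /xi eqxx mulrAC.
    by rewrite mulr_suml; apply: eq_bigr => b _; rewrite mulrAC.
  rewrite normrN normrM normfV (gtr0_norm L0) ler_pdivrMr//.
  apply: le_trans (approx _ _ _) _.
  - rewrite /xi eqxx distrC; apply: osc; first by rewrite ler01 lexx.
    rewrite posE// opprB addrC subrK ger0_norm// mul1r.
    by apply: le_trans kdel1; rewrite lef_pV2 ?posrE// ler_nat.
  - move=> b j bk jn bj; rewrite /xi ltn_eqF// posE ?(ltnW jn)//.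
    apply: osc; first exact: in01 (ltnW jn).
    have [le1 le2] := block_close q1 (isT : (0 < k)%N) kt4 bk bj.
    apply: le_trans kdel.
    have -> : 1 - j%:R / n%:R - (1 - b%:R / k%:R) = (b%:R * n%:R - j%:R * k%:R) / n%:R / k%:R :> R.
      by field; rewrite !gt_eqF.
    rewrite normrM normfV (gtr0_norm kR) ler_pM2r ?invr_gt0//.
    rewrite normrM normfV (gtr0_norm nR) ler_pdivrMr//.
    move: le1 le2; rewrite -2!(ler_nat R) !natrD !natrM => le1 le2.
    by rewrite ler_norml; apply/andP; split; lra.
  - by move=> j /andP[_ jn]; rewrite posE ?(ltnW jn)//; apply: FM; exact: in01 (ltnW jn).
  rewrite mulrDl mulrC lerD2l.
  move: cerr; rewrite sub0r normrN ger0_norm ?divr_ge0// ?(ltW L0)//.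
  rewrite ler_pdivrMr// => cerr.
  apply: (@le_trans _ _ ((M + 1) * (error q n k)%:R)).
    by rewrite ler_wpM2r// lerDl.
  rewrite mulrC -ler_pdivlMr ?ltr_wpDl//; apply: le_trans cerr _.
  by rewrite mulrAC.
have := ler_distD lim (qR^-1 * F 1 + (1 - qR^-1) * I) (S / L n).
move=> /le_trans; apply.
have := ler_distD (avg n) lim (S / L n).
move=> h; lra.
Unshelve. all: by end_near. Qed.

End MeanLimit.

(** * Integrals against the uniform law and the limit law *)

Section UniformIntegral.
Context {d : Order.disp_t} {A : finOrderType d} {q : nat}.
Variables (R : realType) (cardA : #|A| = q) (q_gt1 : (1 < q)%N) (n : nat).
Local Notation L := (lyndon_word cardA q_gt1 n).

Lemma sum_lyndon_word (V : nmodType) (G : seq A -> V) :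
  \sum_(w : L) G (lyndon_tuple w) = \sum_(w <- words n | lyndon w) G w.
Proof.
rewrite -[RHS]big_filter -(big_map (fun w : L => tval (lyndon_tuple w)) xpredT G).
apply: perm_big; apply: uniq_perm.
- rewrite map_inj_uniq ?index_enum_uniq// => u v /val_inj uv; exact: val_inj.
- by rewrite filter_uniq// uniq_words.
move=> w; rewrite mem_filter mem_words; apply/mapP/andP => [[v _ ->]|[lw wn]].
  by rewrite size_tuple eqxx; split=> //; case: v.
by exists (LyndonWord cardA q_gt1 (lyndon_tuple := Tuple wn) lw); rewrite ?mem_index_enum.
Qed.

Lemma card_lyndon_word : #|{: L}| = nwords n (@lyndon _ A).
Proof.
rewrite -sum1_card /nwords -sum1_count.
exact: (sum_lyndon_word (fun=> 1%N)).
Qed.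

(** The space is the disjoint union of its points, all of the same mass. *)
Lemma integral_lyndon_unif (h : L -> R) :
  (\int[lyndon_unif R cardA q_gt1 n]_w (h w)%:E)%E =
  ((\sum_(w : L) h w) / #|{: L}|%:R)%:E.
Proof.
have TE : [set: L] = \big[setU/set0]_(w <- index_enum L) [set w].
  rewrite -bigcup_seq; apply/seteqP; split => // w _.
  by exists w => //=; rewrite mem_index_enum.
rewrite TE integral_bigsetU_EFin ?index_enum_uniq//; last first.
  by move=> u v _ _ [w [-> ->]].
rewrite mulr_suml -sumEFin; apply: eq_bigr => w _.
rewrite (eq_integral (cst (h w)%:E)); last by move=> u; rewrite inE => ->.
rewrite integral_cst//= /lyndon_unif /mscale /= /counting asboolT//.
by rewrite fset_set1 finmap.cardfs1 mule1.
Qed.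

Lemma integrable_lyndon_unif (h : L -> R) :
  (lyndon_unif R cardA q_gt1 n).-integrable setT (EFin \o h).
Proof.
apply/integrableP; split => //.
rewrite (eq_integral (fun w => `|h w|%:E)); last by move=> w _.
by rewrite integral_lyndon_unif ltry.
Qed.

End UniformIntegral.

Section LimitIntegral.
Variables (R : realType) (q : nat) (q_gt1 : (1 < q)%N).
Local Notation mu := (@lebesgue_measure R).
Local Notation mu01 := (mrestr mu (measurable_itv `[0 : R, 1[)).

(** For the restricted measure, the complement of [[0, 1[] is null, and inside [[0, 1[] it agrees
    with Lebesgue measure. *)
Lemma ge0_integral_limit_law (f : R -> R) : measurable_fun [set: measurableTypeR R] f ->
  (forall x, 0 <= f x) ->
  (\int[limit_law R q_gt1]_x (f x)%:E)%E =
  ((q%:R^-1 * f 1)%:E +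
   ((q - 1)%N%:R / q%:R)%:E * \int[mu]_(x in `[0%R, 1%R[) (f x)%:E)%E.
Proof.
move=> mf f0; move/measurable_EFinP : (mf) => mEf.
rewrite /limit_law ge0_integral_measure_add//=; last first.
  by move=> x _; rewrite lee_fin.
rewrite !ge0_integral_mscale//=; try by move=> x _; rewrite lee_fin.
rewrite integral_dirac// diracT mul1e EFinM; congr (_ + _ * _)%E.
rewrite (@ge0_negligible_integral _ _ _ _ setT
  (~` `[0 : R, 1[ : set (measurableTypeR R)))//=; last 3 first.
- exact: measurableC.
- by move=> x _; rewrite lee_fin.
- by rewrite /mrestr setICl measure0.
rewrite setTD setCK; apply: eq_measure_integral => B mB B01.
by rewrite /= /mrestr setIidl.
Qed.

(** Reduces to the nonnegative case through positive and negative parts, both of finite integral on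
    [[0, 1[]. *)
Lemma integral_limit_law (f : R -> R) : continuous f ->
  (\int[limit_law R q_gt1]_x (f x)%:E)%E =
  (q%:R^-1 * f 1 + (1 - q%:R^-1) * (\int[mu]_(x in `[0%R, 1%R[) f x)%R)%:E.
Proof.
move=> cf; have mf : measurable_fun setT f by exact: continuous_measurable_fun.
have int01 : mu.-integrable `[0%R, 1%R[ (EFin \o f).
  by apply: integrableS (integrable_segment cf 0 1) => //; exact: subset_itv_co_cc.
have intp : mu.-integrable `[0%R, 1%R[ (EFin \o f^\+).
  by rewrite -funerpos; exact: integrable_funepos.
have intn : mu.-integrable `[0%R, 1%R[ (EFin \o f^\-).
  by rewrite -funerneg; exact: integrable_funeneg.
have posneg (m : {measure set (measurableTypeR R) -> \bar R}) (D : set R) :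
    (\int[m]_(x in D) (f x)%:E =
     \int[m]_(x in D) (f^\+ x)%:E - \int[m]_(x in D) (f^\- x)%:E)%E.
  rewrite integralE; congr (_ - _)%E; apply: eq_integral => x _.
    by rewrite -[RHS]/((EFin \o f^\+) x) -funerpos.
  by rewrite -[RHS]/((EFin \o f^\-) x) -funerneg.
rewrite /Rintegral !posneg !ge0_integral_limit_law//; last 2 first.
- exact: measurable_funrneg.
- exact: measurable_funrpos.
have /fineK <- : (\int[mu]_(x in `[0%R, 1%R[) (f^\+ x)%:E)%E \is a fin_num.
  by exact: integrable_fin_num.
have /fineK <- : (\int[mu]_(x in `[0%R, 1%R[) (f^\- x)%:E)%E \is a fin_num.
  by exact: integrable_fin_num.
set u := fine _; set v := fine _.
rewrite -!EFinM -!EFinD /=; congr EFin.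
have -> : f 1 = f^\+ 1 - f^\- 1 by rewrite -{1}(funrposBneg f).
have -> : (q - 1)%N%:R / q%:R = 1 - q%:R^-1 :> R.
  by rewrite natrB ?(ltnW q_gt1)// mulrBl divff ?mul1r// pnatr_eq0; lia.
ring.
Qed.

End LimitIntegral.

Lemma exists_min_letter (d : Order.disp_t) (A : finOrderType d) :
  (0 < #|A|)%N -> exists a : A, forall x, (a <= x)%O.
Proof.
move=> /card_gt0P[x0 _]; case: (@arg_minP _ _ _ x0 xpredT id isT) => a _ amin.
by exists a => x; exact: amin.
Qed.

(** Serves both claims of the theorem: bounded continuous test functions for the convergence in
    distribution, powers for the moments. *)
Lemma integral_rfactor_ratio_cvg (R : realType) (d : Order.disp_t)
    (A : finOrderType d) (q : nat) (cardA : #|A| = q) (q_gt1 : (1 < q)%N)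
    (f : R -> R) : continuous f ->
  (\int[lyndon_unif R cardA q_gt1 n]_w
     (f (rfactor_ratio R cardA q_gt1 n w))%:E)%E @[n --> \oo] -->
  (\int[limit_law R q_gt1]_x (f x)%:E)%E.
Proof.
subst q => cf; have [a a_min] := exists_min_letter (ltnW q_gt1).
rewrite integral_limit_law//; apply: cvg_EFin.
  by apply: nearW => n; rewrite integral_lyndon_unif.
apply: cvg_trans (lyndon_mean_cvg a_min q_gt1 cf); apply: near_eq_cvg.
near=> n; rewrite /= integral_lyndon_unif /= card_lyndon_word; congr (_ / _).
rewrite -(sum_lyndon_word (erefl _) q_gt1 n (fun w => f ((n - std_pos w)%N%:R / n%:R))).
apply: eq_bigr => w _; rewrite /rfactor_ratio.
have n1 : (1 < n)%N by near: n; exact: nbhs_infty_gt.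
have szw : size (lyndon_tuple w : seq A) = n by rewrite size_tuple.
have [|/andP[_ jn] -> _] := @std_posP _ _ (lyndon_tuple w : seq A); rewrite ?szw//.
by rewrite size_drop szw.
Unshelve. all: by end_near. Qed.

Theorem theorem1p1 (R : realType) (d : Order.disp_t) (A : finOrderType d)
    (q : nat) (cardA : #|A| = q) (q_gt1 : (2 <= q)%N) :
  cvg_in_distribution (fun n => lyndon_unif R cardA q_gt1 n)
    (fun n => rfactor_ratio R cardA q_gt1 n) (limit_law R q_gt1) /\
  forall k : nat,
    'E_(lyndon_unif R cardA q_gt1 n)
      [fun w => (rfactor_ratio R cardA q_gt1 n w ^+ k)%R]%E @[n --> \oo]
      --> (\int[limit_law R q_gt1]_x (x ^+ k)%:E)%E.
Proof.
have X_cvg := @integral_rfactor_ratio_cvg R d A q cardA q_gt1.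
split=> [f cf _|k].
  have fmeas : measurable_fun [set: measurableTypeR R] (EFin \o f).
    by apply/measurable_EFinP; exact: continuous_measurable_fun.
  under eq_cvg => n.
    rewrite (_ : (\int[_]_x _)%E = \int[lyndon_unif R cardA q_gt1 n]_w
      (f (rfactor_ratio R cardA q_gt1 n w))%:E)%E; last first.
      by apply: integral_distribution => //; exact: integrable_lyndon_unif.
    over.
  exact: X_cvg.
have := X_cvg (fun x => x ^+ k) (@exprn_continuous R k).
by under [in X in _ -> X]eq_cvg do rewrite unlock.
Qed.
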